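(* Let $(W,S)$ be a finite Coxeter system with longest element $w_0$, and let $P$ be a probability on $S$ with support $S$. Let $T$ be the transition matrix of the exchange walk on $(W,S)$. Then the exchange walk is ergodic and: (1) The eigenvalues of $T$ are $\lambda_J=\sum_{s\in J}P(s)$ for $J\subseteq S$. (2) The multiplicity of $\lambda_J$ as an eigenvalue is given by $\sum_{K\supseteq J}(-1)^{|K|-|J|}|R(w_Kw_0)|$. (3) The stationary distribution $\pi$ is given, for a reduced decomposition $\alpha=s_1\cdots s_m$ of $w_0$, by $$\pi(\alpha)=\prod_{i=1}^m\frac{P(s_i)}{1-\lambda_{D_R([s_1\cdots s_{i-1}]_W)}}.$$ (4) Let $m=\ell(w_0)$, $n=|S|$ and $p=\min\{P(s):s\in S\}$. Then the mixing time of the exchange walk is $O(m/p)$ in general and $O(mn)$ when $P$ is the uniform distribution on $S$.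
   Context: For $w\in W$, $R(w)$ is the set of reduced expressions (words over $S$) of $w$, $\ell$ the length function, $D_R(w)=\{s\in S:\ell(ws)<\ell(w)\}$ the right descent set, and $[\alpha]_W$ the element of $W$ represented by a word $\alpha$. For $J\subseteq S$, $w_J$ is the longest element of the parabolic subgroup $W_J=\langle J\rangle$. For $s\in S$ and $\alpha=s_1\cdots s_m\in R(w_0)$, there is a unique $i$ such that $e_s(\alpha)=ss_1\cdots s_{i-1}s_{i+1}\cdots s_m\in R(w_0)$. The exchange walk on $(W,S)$ has state set $R(w_0)$ and moves from $\alpha$ to $e_s(\alpha)$ with probability $P(s)$. The mixing time is $t_{mix}(\varepsilon)=\min\{n: \sup_\nu\|T^n\nu-\pi\|_{TV}\le\varepsilon\}$, with $\|\cdot\|_{TV}$ the total variation distance. *)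

(* Defs.v *)
From HB Require Import structures.
From mathcomp Require Import all_boot all_order all_fingroup all_algebra.
From mathcomp Require Import classical_sets reals.

Set Implicit Arguments.
Unset Strict Implicit.
Unset Printing Implicit Defensive.

Import Order.TTheory GRing.Theory Num.Theory.
Local Open Scope ring_scope.

Section Coxeter.
Variable W : finGroupType.
Implicit Types (S J K : {set W}) (w : W) (u : seq W).

(* Bourbaki's definition: S generates W, consists of elements of order 2, and
   W is presented by the relations (s t)^m(s,t) = 1, with m(s,t) the order of
   s t in W; the presentation is expressed by its universal property, against
   arbitrary (possibly infinite) groups. *)
Definition coxeter_system S : Prop :=
  [/\ <<S>>%g = [set: W]%SET,
      {in S, forall s, #[s]%g = 2%N} &
      forall (G : groupType) (f : W -> G),
        {in S &, forall s t, ((f s * f t) ^+ #[s * t]%g)%g = 1%g} ->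
        exists phi : W -> G,
          {morph phi : x y / (x * y)%g} /\ {in S, forall s, phi s = f s}].

(* S ^+ k is the set of all products of k elements of S.  When the involutions
   in S generate W every element is such a product for some k < #|W|, so the
   bound on k is harmless. *)
Definition cox_len S w : nat :=
  \big[minn/#|W|]_(k < #|W| | w \in (S ^+ k)%g) (k : nat).

Definition word_val u : W := (\prod_(s <- u) s)%g.

Definition reduced_word S w u : bool :=
  [&& all [in S] u, word_val u == w & size u == cox_len S w].

(* R(w), as a finite set of tuples. *)
Definition redexps S w : {set (cox_len S w).-tuple W} :=
  [set u : (cox_len S w).-tuple W | reduced_word S w u]%SET.

Definition right_descents S w : {set W} :=
  [set s in S | (cox_len S (w * s)%g < cox_len S w)%N]%SET.

(* w_J: an element of <J> of maximal length (it is unique when (W, S) is a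
   finite Coxeter system and J is a subset of S). *)
Definition longest S J : W := [arg max_(w > 1%g in <<J>>%g) cox_len S w]%N.

Definition w0 S : W := longest S S.

Definition delete_at (i : nat) u : seq W := take i u ++ drop i.+1 u.

(* e_s.  The default value u is never returned for s in S and u in R(w_0), by
   the exchange condition. *)
Definition exchange S (s : W) u : seq W :=
  if [pick i : 'I_(size u) | reduced_word S (w0 S) (s :: delete_at i u)]
    is Some i then s :: delete_at i u else u.

(* The alternating sum over J \subset K \subset S of the |R(w_K w_0)|. *)
Definition multiplicity S J : int :=
  \sum_(K : {set W} | (J \subset K) && (K \subset S))
    (-1) ^+ (#|K| - #|J|) * #|redexps S (longest S K * w0 S)%g|%:Z.

End Coxeter.

(* Distributions are column vectors, so T i j is the probability of moving from
   j to i, and T ^+ k *m nu is the law after k steps started from nu. *)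
Section Markov.
Variables (R : realType) (n : nat).
Implicit Types (T : 'M[R]_n) (mu nu pi : 'cV[R]_n).

Definition distribution nu : Prop :=
  (forall i, 0 <= nu i 0) /\ \sum_i nu i 0 = 1.

Definition irreducible_chain T : Prop :=
  forall i j : 'I_n, exists k : nat, 0 < (T ^+ k) i j.

(* For each state, the gcd of its possible return times is 1. *)
Definition aperiodic_chain T : Prop :=
  forall (i : 'I_n) (d : nat),
    (forall k : nat, (0 < k)%N -> 0 < (T ^+ k) i i -> (d %| k)%N) -> d = 1%N.

Definition ergodic T : Prop := irreducible_chain T /\ aperiodic_chain T.

Definition stationary T nu : Prop := distribution nu /\ T *m nu = nu.

Definition tv_dist mu nu : R :=
  \big[Num.max/0]_(A : {set 'I_n})
    `|\sum_(i in A) mu i 0 - \sum_(i in A) nu i 0|.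

Definition max_dist T pi (k : nat) : R :=
  sup [set tv_dist (T ^+ k *m nu) pi | nu in distribution]%classic.

(* t = t_mix(eps) for the chain T with stationary distribution pi. *)
Definition is_mixing_time T pi (eps : R) (t : nat) : Prop :=
  max_dist T pi t <= eps /\
  (forall k : nat, max_dist T pi k <= eps -> (t <= k)%N).

End Markov.

Section ExchangeWalk.
Variables (R : realType) (W : finGroupType).
Implicit Types (S J : {set W}) (P : W -> R).

(* Values of P outside S are irrelevant. *)
Definition prob_with_support S P : Prop :=
  {in S, forall s, 0 < P s} /\ \sum_(s in S) P s = 1.

Definition lam P J : R := \sum_(s in J) P s.

(* The states, i.e. the elements of R(w_0), are numbered by enum_val. *)
Definition num_states S : nat := #|redexps S (w0 S)|.

Definition state S (i : 'I_(num_states S)) : seq W := enum_val i.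

Definition exchange_walk S P : 'M[R]_(num_states S) :=
  \matrix_(i, j) \sum_(s in S | exchange S s (state j) == state i) P s.

Definition stat_weight S P (u : seq W) : R :=
  \prod_(i < size u)
    (P (nth 1%g u i) / (1 - lam P (right_descents S (word_val (take i u))))).

Definition stat_distr S P : 'cV[R]_(num_states S) :=
  \col_i stat_weight S P (state i).

(* min of P over S; the default 1 is harmless for a probability on S, as then
   S is nonempty and P <= 1 on S. *)
Definition min_prob S P : R := \big[Num.min/1]_(s in S) P s.

End ExchangeWalk.

(* Main.v *)
Require Import Defs.
From HB Require Import structures.
From mathcomp Require Import classical_sets reals.
From mathcomp Require Import all_boot all_order all_fingroup all_algebra.
From mathcomp Require Import zify lra spectral mxred complex.
Import Order.TTheory GRing.Theory Num.Theory.
Local Open Scope ring_scope.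

Set Implicit Arguments.
Unset Strict Implicit.
Unset Printing Implicit Defensive.

(** Reading a word from left to right and dropping every letter that does not
    increase the length of the Demazure (0-Hecke) product of the letters read so
    far turns it into a reduced word; call this the greedy reduction.  One step
    of the exchange walk sends u to the greedy reduction of s u, hence the state
    reached from u with the successive letters a_1, ..., a_k is the greedy
    reduction of a_k ... a_1 u.

    Convergence: as soon as the Demazure product of a_k ... a_1 is w_0, the
    state is the greedy reduction of a_k ... a_1 and no longer depends on u.
    While this product w is not w_0, one more letter lengthens it with
    probability 1 - lambda_{D_R(w)} >= p, so the probability that it is not w_0
    after k letters is at most m / (p k).  This bounds the total variation
    distance to pi, pi being the law of the greedy reduction of an infinite
    random word.

    Spectrum: the trace of T^k counts words a of length k, weighted by P, times
    the states fixed by a.  If K is the set of letters of a, iterating a fixes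
    exactly the states that begin with a certain reduced word of w_K, and there
    are |R(w_K w_0)| of these.  Moebius inversion makes the trace of T^k equal
    to the sum over J of mult(J) lambda_J^k, which determines the characteristic
    polynomial once mult(J) >= 0; this positivity does not involve P and is read
    off from a P for which the lambda_J are distinct. *)
(** * Length and the exchange condition *)

Section NatMin.
Variables (I : eqType) (a : nat) (P : pred I) (F : I -> nat).

Lemma bigminn_le (r : seq I) (j : I) :
  j \in r -> P j -> (\big[minn/a]_(i <- r | P i) F i <= F j)%N.
Proof.
elim: r => // i r IHr; rewrite inE big_cons => /predU1P[<- -> | jr Pj].
  exact: geq_minl.
by case: ifP => _; rewrite ?geq_min IHr ?orbT.
Qed.

Lemma bigminn_ge (r : seq I) (k : nat) : (k <= a)%N ->
  (forall i, i \in r -> P i -> (k <= F i)%N) ->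
  (k <= \big[minn/a]_(i <- r | P i) F i)%N.
Proof.
move=> ka kF; rewrite big_seq_cond; elim/big_ind: _ => // [x y kx ky|i /andP[]].
  by rewrite leq_min kx.
exact: kF.
Qed.

End NatMin.

Section CoxeterGroups.
Local Open Scope group_scope.
Variables (W : finGroupType) (S : {set W}).
Hypothesis Scox : coxeter_system S.
Implicit Types (J K : {set W}) (s t w x y : W) (u v : seq W) (k : nat).

Notation len := (cox_len S).
Notation wordS u := (all [in S] u).

Lemma word_val_nil : word_val [::] = 1 :> W.
Proof. by rewrite /word_val big_nil. Qed.

Lemma word_val_cons s u : word_val (s :: u) = s * word_val u.
Proof. by rewrite /word_val big_cons. Qed.

Lemma word_val_cat u v : word_val (u ++ v) = word_val u * word_val v.
Proof. by rewrite /word_val big_cat. Qed.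

Lemma word_val1 s : word_val [:: s] = s.
Proof. by rewrite /word_val big_seq1. Qed.

Lemma word_val_rcons u s : word_val (rcons u s) = word_val u * s.
Proof. by rewrite -cats1 word_val_cat word_val1. Qed.

Lemma mem_expset (A : {set W}) w k :
  reflect (exists u, [/\ all [in A] u, word_val u = w & size u = k])
          (w \in A ^+ k).
Proof.
apply: (iffP idP) => [|[u [Au <- <-]]].
  elim: k w => [|k IHk] w.
    by rewrite expg0 inE => /eqP->; exists [::]; split; rewrite ?word_val_nil.
  rewrite expgS => /mulsgP[s y As /IHk[u [Au <- <-]] ->].
  by exists (s :: u); split=> //=; [rewrite As | rewrite word_val_cons].
elim: u Au => [_|s u IHu /= /andP[As Au]].
  by rewrite word_val_nil expg0 inE.
by rewrite word_val_cons expgS mem_mulg ?IHu.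
Qed.

Lemma gen_word (A : {set W}) w :
  w \in <<A>> ->
  exists2 u, all [in A] u & word_val u = w.
Proof.
move=> /gen_prodgP[n [c Ac ->]].
exists [seq c i | i <- index_enum 'I_n].
  by apply/allP => _ /mapP[i _ ->]; apply: Ac.
by rewrite /word_val big_map.
Qed.

Lemma word_gen (A : {set W}) u : all [in A] u -> word_val u \in <<A>>.
Proof.
move=> Au; rewrite /word_val big_seq; apply: group_prod => s us.
by apply: mem_gen; apply: (allP Au).
Qed.

(** The prefixes of a shortest word have distinct values, so its length is below [#|W|] and the cap
    in [cox_len] is never attained. *)
Lemma len_spec w :
  (exists u, [/\ wordS u, word_val u = w & size u = len w])
  /\ (forall u, wordS u -> word_val u = w -> (len w <= size u)%N).
Proof.
have [genS _ _] := Scox.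
have exk : exists k, w \in S ^+ k.
  have : w \in <<S>> by rewrite genS inE.
  move=> /gen_word[u Su uw].
  by exists (size u); apply/mem_expset; exists u.
case: (ex_minnP exk) => k Sk kmin.
have /mem_expset[u [Su uw uk]] := Sk.
have kW : (k < #|W|)%N.
  pose f (i : 'I_k.+1) := word_val (take i u).
  suff /leq_card : injective f by rewrite card_ord.
  suff f_lt i j : (i < j <= k)%N -> word_val (take i u) <> word_val (take j u).
    move=> i j fij; apply: val_inj => /=.
    have [ij|ji|//] := ltngtP i j.
      by case: (f_lt i j); rewrite ?ij //= -ltnS.
    by case: (f_lt j i); rewrite ?ji //= -ltnS.
  (* If two prefixes had the same value, cutting out the letters between them would give a shorter
     word for [w]. *)
  move=> /andP[ij jk] eqij.
  have := kmin (size (take i u ++ drop j u)).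
  rewrite size_cat size_takel ?uk ?(ltnW (leq_trans ij jk)) // size_drop uk.
  move/implyP; rewrite implybE leqNgt.
  have -> /= : (i + (k - j) < k)%N.
    by move: ij jk; clear; lia.
  rewrite orbF => /negP[]; apply/mem_expset.
  exists (take i u ++ drop j u); split; last first.
  - by rewrite size_cat size_takel ?size_drop ?uk // (ltnW (leq_trans ij jk)).
  - by rewrite word_val_cat eqij -word_val_cat cat_take_drop.
  by apply/allP => s; rewrite mem_cat => /orP[/mem_take|/mem_drop]; apply/allP.
have -> : len w = k.
  apply/eqP; rewrite eqn_leq; apply/andP; split.
    by apply: (@bigminn_le _ _ _ _ _ (Ordinal kW)); rewrite ?mem_index_enum.
  by apply: bigminn_ge => [|i _]; [exact: ltnW | exact: kmin].
split; first by exists u.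
by move=> v Sv vw; apply: kmin; apply/mem_expset; exists v.
Qed.

Definition geodesic u := wordS u && (size u == len (word_val u)).

Lemma geodesicP u : reflect (wordS u /\ size u = len (word_val u)) (geodesic u).
Proof. by apply: (iffP andP) => -[-> /eqP]. Qed.

Lemma reduced_wordE w u : reduced_word S w u = geodesic u && (word_val u == w).
Proof.
rewrite /reduced_word /geodesic; case: (word_val u =P w) => [->|_].
  by rewrite andbT.
by rewrite !andbF.
Qed.

Lemma len_le u : wordS u -> (len (word_val u) <= size u)%N.
Proof. by move=> Su; apply: (len_spec _).2. Qed.

Lemma geodesic_exists w : exists2 u, geodesic u & word_val u = w.
Proof.
have [[u [Su uw us]] _] := len_spec w.
by exists u => //; apply/geodesicP; rewrite uw.
Qed.

Lemma geodesicS u : geodesic u -> wordS u.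
Proof. by case/andP. Qed.

Lemma gen_sqr s : s \in S -> s * s = 1.
Proof.
move=> Ss; have [_ /(_ s Ss) o2 _] := Scox.
by have := expg_order s; rewrite o2.
Qed.

Lemma genV s : s \in S -> s^-1 = s.
Proof. by move=> Ss; apply/eqP; rewrite eq_invg_mul gen_sqr. Qed.

Lemma genKV s x : s \in S -> s * (s * x) = x.
Proof. by move=> Ss; rewrite mulgA gen_sqr ?mul1g. Qed.

Lemma genK s x : s \in S -> x * s * s = x.
Proof. by move=> Ss; rewrite -mulgA gen_sqr ?mulg1. Qed.

Lemma len1 : len 1 = 0%N.
Proof.
by apply/eqP; rewrite -leqn0 -(word_val_nil); apply: (@len_le [::]).
Qed.

Lemma len_eq0 w : (len w == 0%N) = (w == 1).
Proof.
apply/eqP/eqP => [w0|->]; last exact: len1.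
have [u /geodesicP[_ us] uw] := geodesic_exists w.
by move: us; rewrite uw w0 => /size0nil u0; rewrite -uw u0 word_val_nil.
Qed.

Lemma len_mul x y : (len (x * y) <= len x + len y)%N.
Proof.
have [u /geodesicP[Su us] <-] := geodesic_exists x.
have [v /geodesicP[Sv vs] <-] := geodesic_exists y.
by rewrite -us -vs -word_val_cat -size_cat len_le // all_cat Su.
Qed.

Lemma word_val_rev u : wordS u -> word_val (rev u) = (word_val u)^-1.
Proof.
elim: u => [|s u IHu] /=; first by rewrite word_val_nil invg1.
move=> /andP[Ss Su]; rewrite rev_cons word_val_rcons IHu //.
by rewrite word_val_cons invMg (genV Ss).
Qed.

Lemma lenV x : len x^-1 = len x.
Proof.
suff le_lenV y : (len y^-1 <= len y)%N.
  by apply/eqP; rewrite eqn_leq le_lenV -{1}(invgK x) le_lenV.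
have [u /geodesicP[Su us] <-] := geodesic_exists y.
by rewrite -us -word_val_rev // -(size_rev u) len_le ?all_rev.
Qed.

Lemma len_gen s : s \in S -> len s = 1%N.
Proof.
move=> Ss; apply/eqP; rewrite eqn_leq -{1}(word_val1 s) len_le ?lt0n /= ?Ss //.
have [_ /(_ s Ss) o2 _] := Scox.
by rewrite len_eq0; apply: contra_eqN o2 => /eqP->; rewrite order1.
Qed.

(* From the universal property into a group of order 2. *)
Lemma sign_morphism : exists sgn : W -> bool,
  {morph sgn : x y / x * y >-> x (+) y} /\ {in S, forall s, sgn s = true}.
Proof.
have [_ _ univ] := Scox.
pose f (_ : W) : {perm bool} := tperm true false.
have [|phi [phiM phiS]] := univ _ f.
  by move=> s t _ _; rewrite /f tperm2 expg1n.
exists (fun x => phi x : bool); split=> [x y|s Ss]; first by rewrite phiM odd_permM.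
by rewrite phiS // odd_tperm.
Qed.

Lemma len_parity : exists sgn : W -> bool,
  (forall x, sgn x = odd (len x)) /\ (forall s x, s \in S -> sgn (s * x) = ~~ sgn x).
Proof.
have [sgn [sgnM sgnS]] := sign_morphism.
have sgn_cons : (forall s x, s \in S -> sgn (s * x) = ~~ sgn x).
  by move=> s Ss x; rewrite sgnM sgnS.
exists sgn; split=> // x.
have [u /geodesicP[Su us] <-] := geodesic_exists x; rewrite -us => {us}.
elim: u Su => [_|s u IHu /= /andP[Ss Su]].
  by rewrite word_val_nil; have := sgnM 1 1; rewrite mulg1; case: (sgn 1).
by rewrite word_val_cons sgn_cons // IHu.
Qed.

Lemma odd_len_genl s x : s \in S -> odd (len (s * x)) = ~~ odd (len x).
Proof.
have [sgn [sgnE sgnS]] := len_parity.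
by move=> Ss; rewrite -!sgnE sgnS.
Qed.

(* Bourbaki's action of W on reflections and signs; letting the first component
   range over all of W avoids having to carve out the reflections. *)
Definition refl_act s (p : W * bool) : W * bool := (p.1 ^ s, p.2 (+) (p.1 == s)).

Lemma refl_act_inj s : injective (refl_act s).
Proof.
move=> [x e] [y f]; rewrite /refl_act /= => -[/conjg_inj-> ].
by move/addIb->.
Qed.

Definition refl_perm s : {perm W * bool} := perm (@refl_act_inj s).

Lemma dihedral_swap s t n : s \in S -> t \in S ->
  s * (s * t) ^- n = (s * t) ^+ n * s.
Proof.
move=> Ss St; have gs : (s * t)^-1 ^ s = s * t.
  by rewrite conjgE invMg !genV // -mulgA gen_sqr ?mulg1.
by rewrite -expgVn -{2}gs -conjXg conjgE mulgA genK ?(genV Ss).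
Qed.

Lemma refl_perm_iter s t x (e : bool) n : s \in S -> t \in S ->
  ((refl_perm s * refl_perm t) ^+ n) (x, e) =
  (x ^ ((s * t) ^+ n),
   e (+) odd (\sum_(0 <= j < n + n) (x == (s * t) ^+ j * s)%g)).
Proof.
move=> Ss St; elim: n => [|n IHn].
  by rewrite !expg0 perm1 conjg1 big_nil addbF.
rewrite expgSr permM IHn permM !permE /refl_act /=.
rewrite -!conjgM -expgSr addSn addnS !big_nat_recr //= !oddD !oddb !addbA.
have eqconj y z w : (y ^ z == w) = (y == w ^ z^-1).
  by rewrite -(inj_eq (conjg_inj z^-1)) -conjgM mulgV conjg1.
have E1 : s ^ (s * t) ^- n = (s * t) ^+ (n + n) * s.
  by rewrite conjgE invgK dihedral_swap // mulgA -expgD.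
have E2 : t ^ ((s * t) ^+ n * s)^-1 = (s * t) ^+ (n + n).+1 * s.
  by rewrite conjgE invgK invMg (genV Ss) dihedral_swap // -addSn expgD expgSr !mulgA.
by rewrite !eqconj E1 E2.
Qed.

(** With [n] the order of [s * t], the reflections [(s * t) ^+ j * s] have period [n] in [j], so
    each is met an even number of times for [j < n + n] and the signs cancel. *)
Lemma refl_perm_rel s t : s \in S -> t \in S ->
  (refl_perm s * refl_perm t) ^+ #[s * t] = 1.
Proof.
move=> Ss St; apply/permP => -[x e]; rewrite refl_perm_iter // perm1.
rewrite expg_order conjg1; set n := #[s * t].
rewrite (big_cat_nat (n := n)) ?leq_addl //= -{2}[n]add0n big_addn addnK.
under [X in (_ + X)%N]eq_bigr do rewrite expgD expg_order mulg1.
by rewrite addnn odd_double addbF.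
Qed.

Fixpoint flips x u : bool :=
  if u is s :: u' then (x == s) (+) flips (x ^ s) u' else false.

(* The number of i with x = s_1 ... s_i ... s_1 has a parity depending only on
   the element represented by s_1 ... s_k. *)
Lemma flips_val x u v : wordS u -> wordS v -> word_val u = word_val v ->
  flips x u = flips x v.
Proof.
have [_ _ univ] := Scox.
have [|phi [phiM phiS]] := univ _ refl_perm; first exact: refl_perm_rel.
have phiE y (b : bool) (r : seq W) : wordS r ->
    phi (word_val r) (y, b) = (y ^ word_val r, b (+) flips y r).
  elim: r y b => [|s r IHr] y b /=.
    move=> _; rewrite word_val_nil addbF conjg1.
    suff -> : phi 1 = 1 by rewrite perm1.
    by apply: (mulgI (phi 1)); rewrite -phiM !mulg1.
  move=> /andP[Ss Sr]; rewrite word_val_cons phiM phiS // permM permE /refl_act /=.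
  by rewrite IHr // conjgM addbA.
move=> Su Sv uv; have := phiE x false u Su; rewrite uv phiE //.
by case.
Qed.

(** An odd count is nonzero, so [x] is some [s_1 ... s_i ... s_1], and multiplying by it on the left
    cancels [s_i]. *)
Lemma flips_delete x u : wordS u -> flips x u ->
  exists2 i, (i < size u)%N & x * word_val u = word_val (delete_at i u).
Proof.
elim: u x => // s u IHu x /= /andP[Ss Su]; case: (x =P s) => [-> _|_] /=.
  by exists 0%N; rewrite // /delete_at /= drop0 word_val_cons genKV.
move=> /(IHu _ Su)[i iu xu]; exists i.+1 => //.
by rewrite /delete_at /= !word_val_cons -xu [RHS]mulgA -conjgC mulgA.
Qed.

Lemma all_delete (a : pred W) i u : all a u -> all a (delete_at i u).
Proof.
by move=> au; rewrite /delete_at all_cat; apply/andP; split; apply/allP => s;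
   [move/mem_take | move/mem_drop]; apply: allP.
Qed.

Lemma size_delete i u : (i < size u)%N -> size (delete_at i u) = (size u).-1.
Proof.
by move=> iu; rewrite size_cat size_takel ?(ltnW iu) // size_drop; lia.
Qed.

(** Compare [u] with [s :: v], where [v] is a reduced word of [s * word_val u]. Were [s] flipped by
    [v], deleting a letter of [v] would give too short a word for [word_val u]; hence [s] is flipped
    by [s :: v], and so by [u]. *)
Lemma exchange_left s u : wordS u -> s \in S ->
  (len (s * word_val u) < len (word_val u))%N ->
  exists2 i, (i < size u)%N & s * word_val u = word_val (delete_at i u).
Proof.
move=> Su Ss lt_su; apply: flips_delete => //.
have [v /geodesicP[Sv vs] vE] := geodesic_exists (s * word_val u).
rewrite (@flips_val _ _ (s :: v)) //=; last 2 first.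
- by rewrite Ss.
- by rewrite word_val_cons vE genKV.
rewrite eqxx conjgE mulKg; apply/negP => /(flips_delete Sv)[i iv].
rewrite vE genKV // => uE.
have := len_le (all_delete i Sv); rewrite -uE size_delete // vs vE.
by rewrite leqNgt (leq_ltn_trans _ lt_su) ?leq_pred.
Qed.

Lemma exchange_right s u : wordS u -> s \in S ->
  (len (word_val u * s) < len (word_val u))%N ->
  exists2 i, (i < size u)%N & word_val u * s = word_val (delete_at i u).
Proof.
move=> Su Ss lt_us.
have Sru : wordS (rev u) by rewrite all_rev.
have [|i] := exchange_left Sru Ss.
  by rewrite word_val_rev // -{1}(genV Ss) -invMg !lenV.
rewrite size_rev => iu; rewrite word_val_rev // -{1}(genV Ss) -invMg => /(congr1 invg).
rewrite invgK => ->; exists (size u - i.+1)%N; first by rewrite ltn_subrL (leq_ltn_trans _ iu).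
rewrite -word_val_rev ?all_delete //; congr word_val.
rewrite /delete_at rev_cat take_rev drop_rev !revK; congr (_ ++ drop _ _).
by rewrite subnSK.
Qed.

(** The length changes by at most one, and parity excludes equality. *)
Lemma len_genl s x : s \in S ->
  (len (s * x) == (len x).+1) || ((len (s * x)).+1 == len x).
Proof.
move=> Ss; have := len_mul s x; have := len_mul s (s * x); rewrite genKV //.
have := odd_len_genl x Ss; rewrite (len_gen Ss); lia.
Qed.

Lemma len_genr s x : s \in S ->
  (len (x * s) == (len x).+1) || ((len (x * s)).+1 == len x).
Proof. by move=> Ss; rewrite -lenV invMg genV // -(lenV x) len_genl. Qed.

(** * Demazure products and greedy reduction *)

(* lia takes convertible but not identical group products for distinct atoms, so
   the lengths are first generalized. *)
Ltac len_lia :=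
  repeat match goal with
  | H : is_true ?b |- _ =>
      match b with context [cox_len _ _] => revert H end
  | H : ?a = ?b |- _ =>
      match a with context [cox_len _ _] => revert H end
  end;
  repeat match goal with
  | |- context [cox_len ?A ?x] => move: (cox_len A x) => ?
  end; intros; lia.

(** Right and left multiplication by a generator in the 0-Hecke monoid. *)
Definition dem_act w s := if (len w < len (w * s))%N then w * s else w.
Definition dem_actl s w := if (len w < len (s * w))%N then s * w else w.

(** Exchange in a reduced word of [w] followed by [t]: deleting a letter of the first part would
    make [s * w] shorter than [w], so the deleted letter is [t]. *)
Lemma exchange_absorb s w t : s \in S -> t \in S ->
  (len w < len (s * w))%N -> (len (s * w * t) <= len w < len (w * t))%N ->
  s * w = w * t.
Proof.
move=> Ss St sw /andP[swt wt]; have [u gu uw] := geodesic_exists w.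
have /geodesicP[Su us] := gu; have Sut : wordS (rcons u t) by rewrite all_rcons St.
have [|i] := exchange_left Sut Ss.
  by rewrite word_val_rcons uw mulgA (leq_ltn_trans swt).
rewrite size_rcons ltnS leq_eqVlt word_val_rcons uw mulgA.
move=> /predU1P[->|iu].
  rewrite /delete_at -cats1 take_size_cat // drop_oversize ?size_cat ?addn1 //.
  by rewrite cats0 uw => {2}<-; rewrite genK.
have -> : delete_at i (rcons u t) = rcons (delete_at i u) t.
  rewrite /delete_at -!cats1 takel_cat ?(ltnW iu) // -catA drop_cat.
  case: ltnP => // ui; have /eqP-> : i.+1 == size u by rewrite eqn_leq iu.
  by rewrite subnn drop0 drop_size.
rewrite word_val_rcons => /mulIg swE; have := len_le (all_delete i Su).
rewrite -swE size_delete // us uw leqNgt => /negP[].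
by apply: leq_ltn_trans sw; rewrite leq_pred.
Qed.

(** Associativity of the 0-Hecke product. The delicate case is when [s] and [t] both lengthen [w]
    but not each other's result; then [exchange_absorb] gives [s * w = w * t]. *)
Lemma dem_actl_dem_act s w t : s \in S -> t \in S ->
  dem_act (dem_actl s w) t = dem_actl s (dem_act w t).
Proof.
move=> Ss St; rewrite /dem_act /dem_actl.
have := len_genl w Ss; have := len_genr w St.
have := len_genl (w * t) Ss; have := len_genr (s * w) St.
rewrite mulgA => l1 l2 l3 l4.
case: (ltnP (len w) (len (w * t))) => wt;
  case: (ltnP (len w) (len (s * w))) => sw; rewrite ?mulgA.
- case: ltnP => l; case: ltnP => l' //; last 1 first.
  + by apply: exchange_absorb => //; rewrite wt andbT; len_lia.
  + by exfalso; len_lia.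
  + by exfalso; len_lia.
- by rewrite wt ifN // -leqNgt; len_lia.
- by rewrite ifN // -leqNgt; len_lia.
- by rewrite ifN // -leqNgt.
Qed.

Fixpoint greedy w u : seq W :=
  if u is s :: u' then
    if (len w < len (w * s))%N then s :: greedy (w * s) u' else greedy w u'
  else [::].

Definition dem_prod w u := foldl dem_act w u.

Lemma dem_prod_cons w s u : dem_prod w (s :: u) = dem_prod (dem_act w s) u.
Proof. by []. Qed.

Lemma dem_prod_cat w u v : dem_prod w (u ++ v) = dem_prod (dem_prod w u) v.
Proof. exact: foldl_cat. Qed.

Lemma dem_prod_rcons w u s : dem_prod w (rcons u s) = dem_act (dem_prod w u) s.
Proof. by rewrite /dem_prod -cats1 foldl_cat. Qed.

Lemma dem_prod_dem_actl s w u : s \in S -> wordS u ->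
  dem_prod (dem_actl s w) u = dem_actl s (dem_prod w u).
Proof.
move=> Ss; elim: u w => //= t u IHu w /andP[St Su].
by rewrite dem_actl_dem_act // IHu.
Qed.

Lemma greedy_cat w u v : greedy w (u ++ v) = greedy w u ++ greedy (dem_prod w u) v.
Proof. by elim: u w => //= s u IHu w; rewrite IHu /dem_act; case: ifP. Qed.

Lemma greedy_rcons w u s : greedy w (rcons u s) =
  if (len (dem_prod w u) < len (dem_prod w u * s))%N then rcons (greedy w u) s
  else greedy w u.
Proof. by rewrite -cats1 greedy_cat /=; case: ifP; rewrite ?cats1 ?cats0. Qed.

Lemma all_greedy (a : pred W) w u : all a u -> all a (greedy w u).
Proof.
by elim: u w => //= s u IHu w /andP[As Au]; case: ifP => _ /=; rewrite ?As IHu.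
Qed.

Lemma word_val_greedy w u : w * word_val (greedy w u) = dem_prod w u.
Proof.
elim: u w => [|s u IHu] w /=; first by rewrite word_val_nil mulg1.
by rewrite /dem_act; case: ifP => _; rewrite // word_val_cons mulgA IHu.
Qed.

Lemma size_greedy w u : wordS u -> (len w + size (greedy w u))%N = len (dem_prod w u).
Proof.
elim: u w => [|s u IHu] w /=; first by rewrite addn0.
move=> /andP[Ss Su]; rewrite -IHu // /dem_act; case: ifP => // ws.
have := len_genr w Ss => /=; len_lia.
Qed.

Lemma greedy_geodesic u : wordS u -> geodesic (greedy 1 u).
Proof.
move=> Su; apply/geodesicP; split; first exact: all_greedy.
by rewrite -[word_val _]mul1g word_val_greedy -size_greedy // len1.
Qed.

Lemma word_val_greedy1 u : word_val (greedy 1 u) = dem_prod 1 u.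
Proof. by rewrite -word_val_greedy mul1g. Qed.

Lemma greedy_id w u : wordS u -> len (w * word_val u) = (len w + size u)%N ->
  greedy w u = u.
Proof.
elim: u w => //= s u IHu w /andP[Ss Su]; rewrite word_val_cons mulgA => lwu.
have := len_mul (w * s) (word_val u); have := len_le Su; have := len_genr w Ss.
move=> l1 l2 l3; have lws : len (w * s) = (len w).+1.
  by len_lia.
by rewrite lws ltnSn IHu // lwu lws addnS.
Qed.

Lemma greedy1_id u : geodesic u -> greedy 1 u = u.
Proof. by move=> /geodesicP[Su us]; apply: greedy_id; rewrite // mul1g len1 us. Qed.

Lemma dem_prod1_geodesic u : geodesic u -> dem_prod 1 u = word_val u.
Proof. by move=> /greedy1_id gu; rewrite -word_val_greedy1 gu. Qed.

(** A right descent is a letter absorbed by [dem_act], and absorption passes through the left action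
    by commutation. *)
Lemma dem_actl_desc s w t : s \in S -> t \in S ->
  ~~ (len w < len (w * t))%N -> ~~ (len (dem_actl s w) < len (dem_actl s w * t))%N.
Proof.
move=> Ss St wt; have := dem_actl_dem_act w Ss St; rewrite /dem_act (negPf wt).
by case: ifP => // lt_z zt; move: lt_z; rewrite zt ltnn.
Qed.

(** By [dem_actl_desc], letters dropped when reading from [w] are dropped from [dem_actl s w] too,
    so removing them beforehand is harmless. *)
Lemma greedy_dem_actl s w u : s \in S -> wordS u ->
  greedy (dem_actl s w) (greedy w u) = greedy (dem_actl s w) u.
Proof.
move=> Ss; elim: u w => //= t u IHu w /andP[St Su].
case: (boolP (_ < len (w * t))%N) => wt /=; last first.
  by rewrite (negPf (dem_actl_desc Ss St wt)) IHu.
have := dem_actl_dem_act w Ss St; rewrite /dem_act wt => dE.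
by case: ifP dE => _ ->; rewrite IHu.
Qed.

Lemma greedy_cons_greedy s u : s \in S -> wordS u ->
  greedy 1 (s :: greedy 1 u) = greedy 1 (s :: u).
Proof.
move=> Ss Su /=; have := greedy_dem_actl 1 Ss Su.
by rewrite /dem_actl mulg1 mul1g len1 len_gen //= => ->.
Qed.

(** Many steps of the walk thus amount to one greedy reduction at the end. *)
Lemma greedy_cat_greedy u v : wordS u -> wordS v ->
  greedy 1 (u ++ greedy 1 v) = greedy 1 (u ++ v).
Proof.
move=> Su Sv; elim: u Su => [_|s u IHu /= /andP[Ss Su]].
  by rewrite /= greedy1_id ?greedy_geodesic.
rewrite -[LHS]greedy_cons_greedy ?all_cat ?Su ?all_greedy // IHu //.
by rewrite greedy_cons_greedy // all_cat Su.
Qed.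

Lemma dem_prod_cons1 s u : s \in S -> wordS u ->
  dem_prod 1 (s :: u) = dem_actl s (dem_prod 1 u).
Proof.
move=> Ss Su; rewrite -dem_prod_dem_actl // dem_prod_cons /dem_act /dem_actl.
by rewrite mulg1 mul1g len1 len_gen.
Qed.

(** * Longest elements *)

Lemma dem_actE w s : ~~ (len w < len (w * s))%N -> dem_act w s = w.
Proof. by rewrite /dem_act => /negPf->. Qed.

Lemma dem_prod_fix w u : all (fun s => ~~ (len w < len (w * s))%N) u -> dem_prod w u = w.
Proof. by elim: u => //= s u IHu /andP[ws wu]; rewrite dem_actE // IHu. Qed.

Lemma dem_prod_id_desc w u : wordS u -> dem_prod w u = w ->
  all (fun s => ~~ (len w < len (w * s))%N) u.
Proof.
elim: u => //= s u IHu /andP[Ss Su]; rewrite /dem_act; case: ifP => [ws wE|ws].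
  by have := size_greedy (w * s) Su; rewrite wE; move: ws; len_lia.
exact: IHu.
Qed.

Lemma dem_prod_id_or w u : wordS u -> (dem_prod w u == w) || (len w < len (dem_prod w u))%N.
Proof.
move=> Su; have := size_greedy w Su; have := word_val_greedy w u.
case: (greedy w u) => [<- _|s r _ <-]; first by rewrite word_val_nil mulg1 eqxx.
by rewrite addnS ltnS leq_addr orbT.
Qed.

(** Exchange only deletes letters, so shortening a word over [J] never leaves [J]. *)
Lemma gen_geodesic J w : J \subset S -> w \in <<J>> ->
  exists u, [/\ all [in J] u, geodesic u & word_val u = w].
Proof.
move=> /subsetP sJS /gen_word[u Ju <-].
elim/last_ind: u Ju => [_|u s IHu].
  by exists [::]; split=> //; apply/geodesicP; rewrite word_val_nil len1.
rewrite all_rcons word_val_rcons => /andP[Js /IHu[v [Jv gv <-]]].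
have Ss := sJS s Js; have /geodesicP[Sv vs] := gv.
case/orP: (len_genr (word_val v) Ss) => /eqP l.
  exists (rcons v s); rewrite all_rcons Js word_val_rcons; split=> //.
  by apply/geodesicP; rewrite all_rcons size_rcons word_val_rcons Ss vs l.
have [|i iv vsE] := exchange_right Sv Ss; first by rewrite -l.
exists (delete_at i v); rewrite vsE all_delete //; split=> //.
apply/geodesicP; rewrite all_delete // -vsE size_delete //; split=> //.
by rewrite vs -l.
Qed.

Lemma longestP J : longest S J \in <<J>> /\
  {in <<J>>, forall x, len x <= len (longest S J)}%N.
Proof. by rewrite /longest; case: arg_maxnP => //= w Jw maxw. Qed.

Lemma dem_prod_cat_longest J u v : J \subset S -> all [in J] u -> geodesic v ->
  word_val v = longest S J -> dem_prod 1 (u ++ v) = longest S J.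
Proof.
move=> /subsetP sJS; have [wJ maxJ] := longestP J.
move=> Ju gv vJ; have Sv := geodesicS gv.
elim: u Ju => [_|s u IHu /= /andP[Js Ju]]; first by rewrite dem_prod1_geodesic.
have Ss := sJS _ Js.
have Su : wordS u by apply: sub_all Ju.
rewrite [LHS]dem_prod_cons1 ?all_cat ?Su // IHu // /dem_actl ifN // -leqNgt maxJ //.
by rewrite groupM // mem_gen.
Qed.

(** Evaluate in two ways the Demazure product of a reduced word of [w] followed by one of
    [longest S J]: the second word absorbs the first, while each of its letters is a descent of
    [w]. *)
Lemma longest_uniq J w : J \subset S -> w \in <<J>> ->
  {in J, forall s, len (w * s) <= len w}%N -> w = longest S J.
Proof.
move=> sJS Jv descv; have [wJ _] := longestP J.
have [x [Jx gx xw]] := gen_geodesic sJS Jv.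
have [y [Jy gy yw]] := gen_geodesic sJS wJ.
rewrite -(dem_prod_cat_longest sJS Jx gy yw) dem_prod_cat dem_prod1_geodesic // xw.
by rewrite dem_prod_fix //; apply: sub_all Jy => s /descv; rewrite -leqNgt.
Qed.

Lemma longestV J : J \subset S -> (longest S J)^-1 = longest S J.
Proof.
move=> sJS; have [wJ maxJ] := longestP J.
apply: longest_uniq => // [|s Js]; first by rewrite groupV.
by rewrite lenV maxJ // groupM ?groupV // mem_gen.
Qed.

Lemma len_w0 x : (len x <= len (w0 S))%N.
Proof. by apply: (longestP S).2; have [-> _ _] := Scox; rewrite inE. Qed.

Lemma right_descentsP w s :
  (s \in right_descents S w) = (s \in S) && ~~ (len w < len (w * s))%N.
Proof.
rewrite inE; case Ss: (s \in S) => //=.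
by have := len_genr w Ss; len_lia.
Qed.

Lemma w0_uniq w : S \subset right_descents S w -> w = w0 S.
Proof.
move=> /subsetP Sv; apply: longest_uniq => //.
  by have [-> _ _] := Scox; rewrite inE.
by move=> s Ss; have := Sv s Ss; rewrite right_descentsP Ss -leqNgt.
Qed.

Lemma dem_prod_cat_w0 u v : wordS u -> reduced_word S (w0 S) v ->
  dem_prod 1 (u ++ v) = w0 S.
Proof.
by rewrite reduced_wordE => Su /andP[gv /eqP vw]; apply: dem_prod_cat_longest.
Qed.

Lemma greedy_w0 v : wordS v -> greedy (w0 S) v = [::].
Proof.
move=> Sv; apply: size0nil; have := size_greedy (w0 S) Sv.
by have := len_w0 (dem_prod (w0 S) v); len_lia.
Qed.

Lemma greedy_reduced u : wordS u ->
  reduced_word S (w0 S) (greedy 1 u) = (dem_prod 1 u == w0 S).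
Proof. by move=> Su; rewrite reduced_wordE greedy_geodesic // word_val_greedy1. Qed.

Lemma greedy_cat_reduced u v : wordS u -> reduced_word S (w0 S) v ->
  reduced_word S (w0 S) (greedy 1 (u ++ v)).
Proof.
move=> Su rv; rewrite greedy_reduced ?dem_prod_cat_w0 //.
by rewrite all_cat Su; case/and3P: rv.
Qed.

(** Split [u] as [a t b] at the deleted letter [t]. Then [s a t = a] in the group, so the greedy
    reading of [s a t b] keeps [s a], drops [t] and keeps [b]. *)
Lemma exchangeE s u : s \in S -> reduced_word S (w0 S) u ->
  exchange S s u = greedy 1 (s :: u).
Proof.
move=> Ss; rewrite reduced_wordE => /andP[gu /eqP uw0].
have /geodesicP[Su us] := gu.
(* The default is excluded: [s] shortens [w0 S], which has maximal length, so the exchange condition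
   supplies a position. *)
rewrite /exchange; case: pickP => [i|none]; last first.
  have lt_su : (len (s * word_val u) < len (word_val u))%N.
    have := len_genl (word_val u) Ss; have := len_w0 (s * word_val u).
    by rewrite uw0; len_lia.
  have [i iu sE] := exchange_left Su Ss lt_su.
  have := none (Ordinal iu); rewrite /= reduced_wordE word_val_cons -sE genKV // uw0 eqxx.
  move/negbT; rewrite andbT => /geodesicP[]; rewrite /= word_val_cons -sE genKV //.
  by rewrite Ss all_delete // size_delete // prednK // (leq_ltn_trans _ iu).
rewrite reduced_wordE word_val_cons => /andP[gd /eqP dE].
set a := take i u; set b := drop i.+1 u; set t := nth 1 u i.
have uE : u = rcons a t ++ b by rewrite -take_nth // cat_take_drop.
have /geodesicP[] := gd; rewrite /= word_val_cons => /andP[_ Sab] sab.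
have [Sa Sb] : wordS a /\ wordS b by apply/andP; rewrite -all_cat.
have St : t \in S by apply: (allP Su); apply: mem_nth.
have sat : s * word_val a * t = word_val a.
  apply: (mulIg (word_val b)); move: dE; rewrite -uw0 -[delete_at i u]/(a ++ b) uE.
  rewrite word_val_cat word_val_cat word_val_rcons mulgA => /(mulIg _) ->.
  by rewrite genK.
have {}sab : len (s * word_val a * word_val b) = (size a + size b).+1.
  by rewrite -size_cat sab -mulgA -word_val_cat.
have lsa : len (s * word_val a) = (size a).+1.
  apply/eqP; rewrite eqn_leq -word_val_cons (@len_le (s :: a)) /= ?Ss //=.
  rewrite word_val_cons -(leq_add2r (size b)) addSn -sab.
  by rewrite (leq_trans (len_mul _ _)) // leq_add2l len_le.
have sa_id : greedy 1 (s :: a) = s :: a.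
  by apply: greedy1_id; apply/geodesicP; rewrite /= Ss Sa word_val_cons lsa.
have dsa : dem_prod 1 (s :: a) = s * word_val a.
  by rewrite -word_val_greedy1 sa_id word_val_cons.
rewrite -[RHS]/(greedy 1 (s :: u)).
have -> : s :: u = (s :: a) ++ t :: b by rewrite [in LHS]uE cat_rcons.
rewrite greedy_cat sa_id dsa [greedy _ (t :: _)]/= sat.
have -> : (len (s * word_val a) < len (word_val a))%N = false.
  by rewrite lsa ltnNge (leq_trans (len_le Sa)).
rewrite greedy_id //.
by rewrite sab lsa addSn.
Qed.

(** * States fixed by a word *)

Fixpoint word_pow u k : seq W := if k is k'.+1 then u ++ word_pow u k' else [::].

Lemma word_powSr u k : word_pow u k.+1 = word_pow u k ++ u.
Proof. by elim: k => [|k IHk] /=; rewrite ?cats0 // -catA -IHk. Qed.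

Lemma all_word_pow (a : pred W) u k : all a u -> all a (word_pow u k).
Proof. by move=> au; elim: k => //= k IHk; rewrite all_cat au. Qed.

Definition content u : {set W} := [set s in u].

Lemma content_subset J u : (content u \subset J) = all [in J] u.
Proof.
apply/subsetP/allP => uJ s; last by rewrite inE; apply: uJ.
by move=> us; apply: uJ; rewrite inE.
Qed.

(** The Demazure products of the powers of [u] lengthen until reading [u] changes nothing; then
    every letter of [u] is a right descent, and [longest_uniq] applies. *)
Lemma greedy_word_pow u : wordS u -> exists k,
  dem_prod 1 (word_pow u k) = longest S (content u).
Proof.
move=> Su; set K := content u.
have sKS : K \subset S by rewrite content_subset.
have Kuk k : dem_prod 1 (word_pow u k) \in <<K>>.
  rewrite -word_val_greedy1 word_gen // all_greedy // all_word_pow //.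
  by apply/allP => s; rewrite inE.
suff uk k : dem_prod 1 (word_pow u k) = longest S K \/
            (k <= len (dem_prod 1 (word_pow u k)))%N.
  by case: (uk (len (w0 S)).+1) => [|/leq_trans/(_ (len_w0 _))];
     rewrite ?ltnn //; exists (len (w0 S)).+1.
elim: k => [|k IHk]; first by right.
rewrite word_powSr dem_prod_cat; set v := dem_prod 1 _ in IHk *.
case/orP: (dem_prod_id_or v Su) => [/eqP vu|lt_v]; last first.
  case: IHk => [vK|kv]; last by right; apply: leq_ltn_trans lt_v.
  left; apply: contraTeq lt_v => _; rewrite -leqNgt vK.
  by apply: (longestP K).2; rewrite -vK -dem_prod_cat -word_powSr.
left; rewrite vu; apply: longest_uniq => // [|s Ks]; first exact: Kuk.
have /allP/(_ s) H := dem_prod_id_desc Su vu.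
by rewrite [X in is_true X]leqNgt H //; move: Ks; rewrite inE.
Qed.

Lemma dem_prod_longest_content u : wordS u ->
  dem_prod (longest S (content u)) u = longest S (content u).
Proof.
move=> Su; apply: dem_prod_fix; apply/allP => s us.
rewrite -leqNgt (longestP _).2 // groupM ?(longestP _).1 //.
by rewrite mem_gen // inE.
Qed.

(* Iterating u turns the state into one that begins with the fixed reduced word
   r of w_K, K being the content of u, and such states are fixed. *)
Lemma greedy_fix u : wordS u -> exists r, [/\ geodesic r,
  word_val r = longest S (content u) &
  forall v, reduced_word S (w0 S) v ->
    greedy 1 (u ++ v) = v <-> exists v', v = r ++ v'].
Proof.
move=> Su; have [k dk] := greedy_word_pow Su.
have Suk : wordS (word_pow u k) by apply: all_word_pow.
exists (greedy 1 (word_pow u k)); split; first exact: greedy_geodesic.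
  by rewrite word_val_greedy1.
move=> v rv; have Sv : wordS v by case/and3P: rv.
split=> [uv|[v' vE]].
  have pow_fix j : greedy 1 (word_pow u j ++ v) = v.
    elim: j => [|j IHj] /=.
      by apply: greedy1_id; move: rv; rewrite reduced_wordE => /andP[].
    by rewrite -catA -greedy_cat_greedy ?all_cat ?all_word_pow // IHj.
  exists (greedy (longest S (content u)) v).
  by rewrite -{1}(pow_fix k) greedy_cat dk.
set w := longest S (content u) in dk.
have Sv' : wordS v' by move: Sv; rewrite vE all_cat => /andP[].
have red_v' : greedy w v' = v'.
  apply: greedy_id => //; have /and3P[_ /eqP vw /eqP vs] := rv.
  have := size_greedy 1 Suk; rewrite dk len1 add0n => <-.
  by rewrite -size_cat -vE vs -vw vE word_val_cat word_val_greedy1 dk.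
have redv : greedy 1 (word_pow u k ++ v') = v by rewrite greedy_cat dk red_v' -vE.
(* The extra copy of [u] may be read after [word_pow u k], when the product is already [w] and all
   its letters are dropped. *)
rewrite -{1}redv greedy_cat_greedy ?all_cat ?Suk // catA -[u ++ _]/(word_pow u k.+1).
rewrite word_powSr -catA greedy_cat dk greedy_cat dem_prod_longest_content // red_v'.
suff -> : greedy w u = [::] by [].
apply: size0nil; have := size_greedy w Su; rewrite dem_prod_longest_content //.
by rewrite -/w; len_lia.
Qed.

Lemma reduced_w0_exists : exists v, reduced_word S (w0 S) v.
Proof.
have [v gv vw] := geodesic_exists (w0 S).
by exists v; rewrite reduced_wordE gv vw eqxx.
Qed.

(** One inequality is subadditivity. For the other, prepend a reduced word [y] of [longest S J] to a
    state and reduce: the new state is [y] followed by a word for [longest S J * w0 S]. *)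
Lemma len_longest_w0 J : J \subset S ->
  (len (longest S J) + len (longest S J * w0 S))%N = len (w0 S).
Proof.
move=> sJS; apply/eqP; rewrite eqn_leq andbC.
rewrite -{1}(mulKg (longest S J) (w0 S)) longestV // len_mul /=.
have [y [Jy gy yw]] := gen_geodesic sJS (longestP J).1.
have [v rv] := reduced_w0_exists; have Sv : wordS v by case/and3P: rv.
have Sy := geodesicS gy.
have := greedy_cat_reduced Sy rv; rewrite greedy_cat greedy1_id //.
rewrite dem_prod1_geodesic // yw reduced_wordE word_val_cat yw.
set v' := greedy _ _ => /andP[/geodesicP[]]; rewrite all_cat => /andP[_ Sv'].
rewrite word_val_cat yw => szE /eqP vE; rewrite -vE -szE size_cat.
rewrite mulgA -{2}(longestV sJS) mulVg mul1g.
have /geodesicP[_ ->] := gy; rewrite yw leq_add2l; exact: len_le.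
Qed.

(** The fixed states are those with the prefix [r] of [greedy_fix]; prepending [r] is the required
    bijection. *)
Lemma card_fix u : wordS u ->
  #|[set v in redexps S (w0 S) | greedy 1 (u ++ v) == v :> seq W]| =
  #|redexps S (longest S (content u) * w0 S)|.
Proof.
move=> Su; have [r [gr rw fixr]] := greedy_fix Su.
have sKS : content u \subset S by rewrite content_subset.
set w := longest S (content u) in rw *.
have wV : w^-1 = w := longestV sKS.
have /geodesicP[Sr rs] := gr; rewrite rw in rs.
have eq_len : (size r + len (w * w0 S))%N = len (w0 S).
  by rewrite rs len_longest_w0.
pose f (v : (len (w * w0 S)).-tuple W) := tcast eq_len [tuple of in_tuple r ++ v].
have f_inj : injective f.
  move=> x y /(congr1 (@tval _ _)); rewrite !val_tcast /= => /eqP.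
  by rewrite eqseq_cat // eqxx => /eqP/val_inj.
rewrite -(card_imset _ f_inj); apply: eq_card => v; rewrite !inE.
apply/andP/imsetP => [[rv /eqP uv]|[v' rv' ->]].
  have /(fixr _ rv)[v' vE] := uv.
  have sv' : size v' == len (w * w0 S).
    by rewrite -(eqn_add2l (size r)) -size_cat -vE eq_len size_tuple.
  exists (Tuple sv'); last by apply: val_inj; rewrite /= val_tcast /= vE.
  move: rv; rewrite inE vE => /and3P[Sv /eqP vw _]; apply/and3P; split=> //.
    by move: Sv; rewrite all_cat => /andP[].
  have {}vw : word_val v' = w * w0 S.
    by rewrite -vw word_val_cat rw mulgA -{1}wV mulVg mul1g.
  exact/eqP.
have rv : reduced_word S (w0 S) (f v').
  move: rv'; rewrite inE val_tcast /= => /and3P[Sv /eqP vw /eqP sv].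
  apply/and3P; split; first by rewrite all_cat Sr.
    by rewrite word_val_cat vw rw mulgA -{1}wV mulVg mul1g.
  by rewrite size_cat sv eq_len.
split=> //; apply/eqP/fixr => //.
by exists v'; rewrite val_tcast.
Qed.

End CoxeterGroups.

(** * The walk as a random word *)

Section WordSums.
Variables (R : realType) (W : finGroupType) (S : {set W}).
Implicit Types (J : {set W}) (P : W -> R) (k : nat).
Implicit Types (f g : seq W -> R) (s : W) (u v : seq W).

(* When P is a probability, the expectation of f on k independent letters; when
   P = 1, the plain sum of f over the words of length k. *)
Fixpoint word_sum P k f : R :=
  if k is k'.+1 then \sum_(s in S) P s * word_sum P k' (fun u => f (s :: u))
  else f [::].

Lemma eq_word_sum P k f g :
  (forall u, all [in S] u -> size u = k -> f u = g u) ->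
  word_sum P k f = word_sum P k g.
Proof.
elim: k f g => [|k IHk] f g fg /=; first exact: fg.
apply: eq_bigr => s Ss; congr (_ * _); apply: IHk => u Su uk.
by apply: fg => /=; rewrite ?Ss ?uk.
Qed.

Lemma word_sum_sum P k (I : Type) (r : seq I) (Q : pred I) (F : I -> seq W -> R) :
  word_sum P k (fun u => \sum_(i <- r | Q i) F i u) =
  \sum_(i <- r | Q i) word_sum P k (F i).
Proof.
elim: k F => [//|k IHk] F /=; rewrite exchange_big /=.
by apply: eq_bigr => s Ss; rewrite IHk mulr_sumr.
Qed.

Lemma word_sumZ P k c f : word_sum P k (fun u => c * f u) = c * word_sum P k f.
Proof.
elim: k f => [//|k IHk] f /=; rewrite mulr_sumr.
by apply: eq_bigr => s Ss; rewrite IHk mulrCA.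
Qed.

Lemma word_sum0 P k : word_sum P k (fun=> 0) = 0.
Proof. by have := word_sumZ P k 0 (fun=> 0); rewrite !mul0r. Qed.

Lemma word_sumD P k f g :
  word_sum P k (fun u => f u + g u) = word_sum P k f + word_sum P k g.
Proof.
elim: k f g => [//|k IHk] f g /=; rewrite -big_split /=.
by apply: eq_bigr => s Ss; rewrite IHk mulrDr.
Qed.

Lemma word_sum_rcons P k f :
  word_sum P k.+1 f = word_sum P k (fun u => \sum_(s in S) P s * f (rcons u s)).
Proof.
elim: k f => [//|k IHk] f.
rewrite -[LHS]/(\sum_(s in S) P s * word_sum P k.+1 (fun u => f (s :: u))).
by rewrite [RHS]/=; apply: eq_bigr => s Ss; rewrite IHk.
Qed.

Lemma word_sum_indic P k v : all [in S] v -> size v = k ->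
  word_sum P k (fun u => (u == v)%:R) = \prod_(s <- v) P s.
Proof.
elim: k v => [|k IHk] [|s v] //=; first by rewrite big_nil.
move=> /andP[Ss Sv] [vk]; rewrite big_cons (bigD1 s) //= big1 ?addr0 => [|t /andP[_ ts]].
  by rewrite -IHk //; congr (_ * _); apply: eq_word_sum => u _ _; rewrite eqseq_cons eqxx.
rewrite (@eq_word_sum _ _ _ (fun=> 0)) ?word_sum0 ?mulr0 // => u _ _.
by rewrite eqseq_cons (negPf ts).
Qed.

Lemma lam_word_sum P J k : J \subset S ->
  lam P J ^+ k = word_sum P k (fun u => (all [in J] u)%:R).
Proof.
move=> /subsetP sJS; elim: k => [//|k IHk] /=.
rewrite exprS IHk /lam mulr_suml big_mkcond [RHS]big_mkcond /=.
apply: eq_bigr => s _; case: (boolP (s \in J)) => [/sJS->|_] /=.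
  by [].
by rewrite word_sum0 mulr0 if_same.
Qed.

Section Probability.
Variable P : W -> R.
Hypothesis PS : prob_with_support S P.

Lemma le_word_sum k f g : (forall u, all [in S] u -> f u <= g u) ->
  word_sum P k f <= word_sum P k g.
Proof.
elim: k f g => [|k IHk] f g fg /=; first exact: fg.
apply: ler_sum => s Ss; rewrite ler_wpM2l ?(ltW (PS.1 _ Ss)) //.
by apply: IHk => u Su; apply: fg; rewrite /= Ss.
Qed.

Lemma word_sum_const k c : word_sum P k (fun=> c) = c.
Proof. by elim: k => //= k ->; rewrite -mulr_suml PS.2 mul1r. Qed.

End Probability.

End WordSums.

Section Walk.
Variables (R : realType) (W : finGroupType) (S : {set W}).
Hypothesis Scox : coxeter_system S.
Implicit Types (J : {set W}) (P : W -> R) (k : nat).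
Implicit Types (f g : seq W -> R) (s : W) (u v : seq W).

Local Notation wordS u := (all [in S] u).
Local Notation red u := (greedy S 1%g u).
Local Notation dem u := (dem_prod S 1%g u).
Local Notation m := (cox_len S (w0 S)).

Lemma state_reduced (i : 'I_(num_states S)) : reduced_word S (w0 S) (state i).
Proof. by have := enum_valP i; rewrite inE. Qed.

Lemma state_word (i : 'I_(num_states S)) : wordS (state i).
Proof. by case/and3P: (state_reduced i). Qed.

Lemma state_inj : injective (@state W S).
Proof. by move=> i j ij; apply: enum_val_inj; apply: val_inj. Qed.

Lemma state_surj v : reduced_word S (w0 S) v ->
  exists i : 'I_(num_states S), state i = v.
Proof.
move=> rv; have sv : size v == m by case/and3P: rv.
have Sv : Tuple sv \in redexps S (w0 S) by rewrite inE.
by exists (enum_rank_in Sv (Tuple sv)); rewrite /state enum_rankK_in.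
Qed.

Lemma sum_state v (F : seq W -> R) : wordS v ->
  \sum_(i < num_states S) (v == state i)%:R * F (state i) =
  (reduced_word S (w0 S) v)%:R * F v.
Proof.
move=> Sv; case: (boolP (reduced_word _ _ _)) => [/state_surj[i <-]|nv].
  rewrite (bigD1 i) //= eqxx big1 ?addr0 // => j ji.
  by rewrite (inj_eq state_inj) eq_sym (negPf ji) mul0r.
rewrite mul0r big1 // => i _; case: eqP => [vi|_]; last by rewrite mul0r.
by move: nv; rewrite vi state_reduced.
Qed.

(** The head of [u] is the letter applied last, so the recursion of [word_sum] matches splitting off
    the left factor of the matrix power. *)
Lemma walk_entry P k (i j : 'I_(num_states S)) :
  (exchange_walk S P ^+ k) i j =
  word_sum S P k (fun u => (red (u ++ state j) == state i)%:R).
Proof.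
elim: k i j => [|k IHk] i j.
  rewrite expr0 mxE /=.
  have := state_reduced j; rewrite reduced_wordE // => /andP[gj _].
  by rewrite greedy1_id // (inj_eq state_inj) eq_sym.
rewrite exprS -[_ * _]/(_ *m _) mxE.
under eq_bigr => l _ do rewrite mxE IHk big_mkcondr /= mulr_suml.
rewrite exchange_big /=; apply: eq_bigr => s Ss.
transitivity (P s * \sum_(l < num_states S)
    (exchange S s (state l) == state i)%:R *
    word_sum S P k (fun u => (red (u ++ state j) == state l)%:R)).
  rewrite mulr_sumr; apply: eq_bigr => l _; rewrite mulrA; congr (_ * _).
  by case: ifP; rewrite ?mulr1 ?mulr0.
congr (_ * _).
under eq_bigr => l _ do rewrite -word_sumZ.
rewrite -word_sum_sum; apply: eq_word_sum => u Su _.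
under eq_bigr => l _ do rewrite mulrC.
have Suj : wordS (u ++ state j) by rewrite all_cat Su state_word.
rewrite (@sum_state _ (fun v => (exchange S s v == state i)%:R)) ?all_greedy //.
have rj := greedy_cat_reduced Scox Su (state_reduced j).
by rewrite rj mul1r exchangeE // greedy_cons_greedy.
Qed.

End Walk.

(** * Spectrum *)

Section Traces.

Lemma trig_mxM (F : comNzRingType) n (A B : 'M[F]_n) :
  is_trig_mx A -> is_trig_mx B ->
  is_trig_mx (A *m B) /\ forall i, (A *m B) i i = A i i * B i i.
Proof.
move=> /is_trig_mxP At /is_trig_mxP Bt; split=> [|i].
  apply/is_trig_mxP => i j ij; rewrite mxE big1 // => l _.
  case: (ltnP i l) => il; first by rewrite At ?mul0r.
  by rewrite Bt ?mulr0 // (leq_ltn_trans il).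
rewrite mxE (bigD1 i) //= big1 ?addr0 // => l li.
case: (ltngtP i l) => [il|il|/val_inj il]; first by rewrite At ?mul0r.
  by rewrite Bt ?mulr0.
by rewrite il eqxx in li.
Qed.

Lemma trig_mxX (F : comNzRingType) n (A : 'M[F]_n) k : is_trig_mx A ->
  is_trig_mx (A ^+ k) /\ forall i, (A ^+ k) i i = A i i ^+ k.
Proof.
move=> At; elim: k => [|k [Akt AkE]].
  split=> [|i]; last by rewrite !expr0 mxE eqxx.
  by apply/is_trig_mxP => i j ij; rewrite expr0 mxE -val_eqE /= ltn_eqF.
rewrite exprS; have [t tE] := trig_mxM At Akt; split=> // i.
by rewrite [LHS]tE AkE exprS.
Qed.

Lemma char_poly_similar (F : fieldType) n (P A B : 'M[F]_n) :
  P \in unitmx -> P *m A = B *m P -> char_poly A = char_poly B.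
Proof.
move=> Pu PA; have detP0 : \det (map_mx polyC P) != 0.
  by rewrite det_map_mx polyC_eq0; move: Pu; rewrite unitmxE unitfE.
apply: (mulfI detP0); rewrite /char_poly -det_mulmx mulrC -det_mulmx; congr (\det _).
by rewrite /char_poly_mx mulmxBl mulmxBr scalar_mxC -!map_mxM PA.
Qed.

(* Schur triangularisation turns the eigenvalues into diagonal entries. *)
Lemma closed_trace_powers (C : numClosedFieldType) n (A : 'M[C]_n) : exists a : 'I_n -> C,
  char_poly A = \prod_i ('X - (a i)%:P) /\
  forall k, \tr (A ^+ k) = \sum_i a i ^+ k.
Proof.
case: n A => [|n] A.
  exists (fun=> 0); rewrite big_ord0 /char_poly det_mx00; split=> // k.
  by rewrite /mxtrace !big_ord0.
have [|P Pu Ptrig] := @Schur C n.+1 A; first by [].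
have Punit := unitarymx_unit Pu; set B := conjmx P A in Ptrig.
have PA : P *m A = B *m P by rewrite /B conjumx // mulmxKV.
exists (fun i => B i i); split=> [|k].
  by rewrite (char_poly_similar Punit PA) char_poly_trig.
have PAk : P *m A ^+ k = B ^+ k *m P.
  elim: k => [|k IHk]; first by rewrite !expr0 mulmx1 mul1mx.
  rewrite !exprS -![_ * _]/(_ *m _) mulmxA PA.
  by rewrite -[LHS]mulmxA IHk mulmxA.
rewrite -[A ^+ k](mulKmx Punit) PAk mxtrace_mulC mulmxK //.
by apply: eq_bigr => i _; rewrite (trig_mxX k Ptrig).2.
Qed.

(* Testing the equality of power sums against a polynomial that vanishes at all
   the values but one. *)
Lemma power_sums_mult (F : numFieldType) (I J : finType) (Q : pred J)
    (a : I -> F) (b : J -> F) (mu : J -> int) :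
  (forall k, \sum_i a i ^+ k = \sum_(j | Q j) (mu j)%:~R * b j ^+ k) ->
  forall c, (#|[set i | a i == c]|)%:Z = \sum_(j | Q j && (b j == c)) mu j.
Proof.
move=> ab c; pose s := [seq a i | i : I] ++ [seq b j | j : J].
pose q := \prod_(x <- s | x != c) ('X - x%:P).
have q0 x : x \in s -> x != c -> q.[x] = 0.
  move=> xs xc; apply/eqP; rewrite /q horner_prod prodf_seq_eq0; apply/hasP.
  by exists x; rewrite // xc hornerXsubC subrr eqxx.
have qc : q.[c] != 0.
  rewrite /q horner_prod prodf_seq_neq0; apply/allP => x _; apply/implyP => xc.
  by rewrite hornerXsubC subr_eq0 eq_sym.
have sum_q : \sum_i q.[a i] = \sum_(j | Q j) (mu j)%:~R * q.[b j].
  under eq_bigr do rewrite horner_coef.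
  under [RHS]eq_bigr do rewrite horner_coef mulr_sumr.
  rewrite exchange_big [RHS]exchange_big /=; apply: eq_bigr => k _.
  by rewrite -mulr_sumr ab mulr_sumr; apply: eq_bigr => j _; rewrite mulrCA.
have as_ i : a i \in s by rewrite mem_cat map_f ?mem_enum.
have bs j : b j \in s by rewrite mem_cat map_f ?mem_enum ?orbT.
apply: (intr_inj (R := F)); apply: (mulIf qc).
transitivity (\sum_i q.[a i]).
  rewrite (bigID (fun i => a i == c)) /= [X in _ = _ + X]big1 => [|i]; last exact: q0.
  rewrite addr0 (eq_bigr (fun=> q.[c])) => [|i /eqP-> //].
  by rewrite sumr_const -mulr_natl cardsE.
rewrite sum_q (bigID (fun j => b j == c)) /= [X in _ + X]big1 => [|j]; last first.
  by case/andP=> _ bc; rewrite q0 ?mulr0.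
rewrite addr0 (eq_bigr (fun j => (mu j)%:~R * q.[c])) => [|j /andP[_ /eqP-> //]].
by rewrite -mulr_suml rmorph_sum.
Qed.

Lemma prod_XsubC_power_sums (F : numFieldType) (I J : finType) (Q : pred J)
    (a : I -> F) (b : J -> F) (mu : J -> nat) :
  (forall k, \sum_i a i ^+ k = \sum_(j | Q j) (mu j)%:R * b j ^+ k) ->
  \prod_i ('X - (a i)%:P) = \prod_(j | Q j) ('X - (b j)%:P) ^+ mu j.
Proof.
move=> ab; have mult c := power_sums_mult (mu := fun j => (mu j)%:Z) ab c.
pose s := flatten [seq nseq (mu j) (b j) | j <- [seq j <- index_enum J | Q j]].
have -> : \prod_(j | Q j) ('X - (b j)%:P) ^+ mu j = \prod_(x <- s) ('X - x%:P).
  rewrite big_flatten /= big_map big_filter; apply: eq_bigr => j _.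
  by rewrite big_nseq iter_mulr_1.
rewrite -(big_map a predT (fun x => 'X - x%:P)); apply: perm_big.
apply/allP => c _; rewrite /= count_flatten -map_comp sumnE big_map big_filter.
have := mult c; rewrite -(big_morph Posz PoszD (erefl _)) => -[multE].
rewrite count_map -sum1_count (eq_bigl [in [set i | a i == c]]) => [|i]; last first.
  by rewrite !inE.
rewrite sum1_card multE big_mkcondr /=; apply/eqP/eq_bigr => j _.
by rewrite count_nseq /=; case: eqP; rewrite ?mul1n ?mul0n.
Qed.

(** The matrix is carried to the complex extension of [R], where it can be triangularised, and the
    identity is pulled back by injectivity. The sum at [c] counts eigenvalues equal to [c], hence is
    nonnegative; this later yields the positivity of [multiplicity]. *)
Lemma trace_powers_mult (R : rcfType) n (A : 'M[R]_n) (J : finType) (Q : pred J)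
    (b : J -> R) (mu : J -> int) :
  (forall k, \tr (A ^+ k) = \sum_(j | Q j) (mu j)%:~R * b j ^+ k) ->
  (forall c, 0 <= \sum_(j | Q j && (b j == c)) mu j) /\
  ((forall j, Q j -> 0 <= mu j) ->
   char_poly A = \prod_(j | Q j) ('X - (b j)%:P) ^+ `|mu j|%N).
Proof.
move=> trA; set h := real_complex R.
have [a [chA trAk]] := closed_trace_powers (map_mx h A).
have powers k : \sum_i a i ^+ k = \sum_(j | Q j) (mu j)%:~R * h (b j) ^+ k.
  rewrite -trAk; have -> : map_mx h A ^+ k = map_mx h (A ^+ k).
    elim: k => [|k IHk]; first by rewrite !expr0 map_mx1.
    by rewrite !exprS -![_ * _]/(_ *m _) map_mxM IHk.
  rewrite trace_map_mx trA rmorph_sum; apply: eq_bigr => j _.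
  by rewrite rmorphM rmorphXn rmorph_int.
split=> [c|mu0].
  have := power_sums_mult powers (h c).
  rewrite (eq_bigl (fun j => Q j && (b j == c))) => [<- //|j].
  by rewrite fmorph_eq.
apply: (@map_poly_inj _ _ h); rewrite map_char_poly chA.
rewrite rmorph_prod /=.
rewrite (@prod_XsubC_power_sums _ _ _ Q a (fun j => h (b j)) (fun j => `|mu j|%N)) => [|k].
  by apply: eq_bigr => j _; rewrite rmorphXn rmorphB /= map_polyX map_polyC.
rewrite powers; apply: eq_bigr => j Qj; congr (_ * _).
by rewrite -{1}(gez0_abs (mu0 j Qj)).
Qed.

End Traces.

(** * Subset sums of powers of two *)

Lemma binary_inj n (b c : nat -> bool) :
  (\sum_(i < n) b i * 2 ^ i = \sum_(i < n) c i * 2 ^ i)%N ->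
  forall i, (i < n)%N -> b i = c i.
Proof.
elim: n b c => // n IHn b c.
have step (d : nat -> bool) : (\sum_(i < n.+1) d i * 2 ^ i =
    d 0%N + (\sum_(i < n) d i.+1 * 2 ^ i).*2)%N.
  rewrite big_ord_recl muln1 -muln2 big_distrl; congr (_ + _)%N.
  by apply: eq_bigr => i _; rewrite /= expnSr mulnA.
rewrite !step => eq_bc [_|i].
  by have := congr1 odd eq_bc; rewrite !oddD !odd_double !addbF !oddb.
have := congr1 half eq_bc; rewrite !half_bit_double ltnS.
by move/(IHn (fun i => b i.+1) (fun i => c i.+1)); apply.
Qed.

Lemma sum_pow2_inj (T : finType) (A B : {set T}) :
  (\sum_(x in A) 2 ^ index x (enum T) = \sum_(x in B) 2 ^ index x (enum T))%N ->
  A = B.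
Proof.
move=> AB; apply/setP => x0.
have sumE (C : {set T}) : (\sum_(x in C) 2 ^ index x (enum T) =
    \sum_(i < size (enum T)) (nth x0 (enum T) i \in C) * 2 ^ i)%N.
  rewrite big_mkcond /= -big_enum /= (big_nth x0) big_mkord.
  apply: eq_bigr => i _; rewrite index_uniq ?enum_uniq //.
  by case: ifP; rewrite ?mul1n ?mul0n.
move: AB; rewrite !sumE.
move=> /(@binary_inj _ (fun i => nth x0 _ i \in A)
  (fun i => nth x0 _ i \in B)).
move/(_ (index x0 (enum T))); rewrite nth_index ?mem_enum //; apply.
by rewrite index_mem mem_enum.
Qed.

(** * Moebius inversion and the spectrum of the walk *)

Section Spectrum.

(** If [A] is proper in [K], toggling a fixed [x] of [K] outside [A] pairs sets of opposite sign. *)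
Lemma sum_sign_interval (T : finType) (A K : {set T}) : A \subset K ->
  \sum_(J : {set T} | (A \subset J) && (J \subset K)) (-1) ^+ (#|K| - #|J|) =
  (A == K)%:R :> int.
Proof.
move=> sAK; case: (eqVneq A K) => [<-|AK].
  rewrite (big_pred1 A) ?subnn // => J.
  by rewrite [in RHS]/= eqEsubset andbC.
have /properP[_ [x Kx Ax]] : A \proper K by rewrite properEneq AK.
rewrite (bigID (fun J : {set T} => x \in J)) /=.
rewrite (reindex_onto (fun J : {set T} => x |: J) (fun J => J :\ x)) /=; last first.
  by move=> J /andP[_ xJ]; rewrite setD1K.
rewrite (eq_bigl (fun J : {set T} => (A \subset J) && (J \subset K) && (x \notin J))).
  rewrite -big_split big1 //= => J /andP[/andP[AJ JK] xJ].
  have ltJK : (#|J| < #|K|)%N.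
    by apply/proper_card/properP; split=> //; exists x.
  rewrite cardsU1 xJ add1n -[in X in _ + X](subnSK ltJK) exprS mulN1r.
  exact: subrr.
move=> J /=; rewrite in_setU1 eqxx andbT; case: (boolP (x \in J)) => xJ.
  rewrite !andbF; apply/negbTE; rewrite negb_and orbC; apply/orP; left.
  by apply/eqP => /setP/(_ x); rewrite !inE eqxx xJ.
rewrite setU1K // eqxx !andbT subUset sub1set Kx /=; congr (_ && _).
apply/idP/idP => [|AJ]; last exact: subset_trans (subsetUr _ _).
move/subsetP => AxJ; apply/subsetP => y Ay; have := AxJ y Ay.
by rewrite in_setU1 => /predU1P[yx|//]; rewrite -yx Ay in Ax.
Qed.

Lemma sum_multiplicity (W : finGroupType) (S A : {set W}) : A \subset S ->
  \sum_(J : {set W} | (A \subset J) && (J \subset S)) multiplicity S J =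
  #|redexps S (longest S A * w0 S)%g|%:Z.
Proof.
move=> sAS; rewrite /multiplicity.
rewrite (exchange_big_dep (fun K : {set W} => (A \subset K) && (K \subset S))) /=; last first.
  by move=> J K /andP[AJ _] /andP[JK ->]; rewrite (subset_trans AJ).
rewrite (bigD1 A) /= ?subxx // [X in _ + X]big1 ?addr0 => [|K /andP[/andP[AK KS] KA]].
  rewrite -mulr_suml (eq_bigl (fun J : {set W} => (A \subset J) && (J \subset A))) => [|J].
    by rewrite sum_sign_interval // eqxx mul1r.
  rewrite sAS; case: (boolP (J \subset A)) => [JA|]; rewrite ?andbF //.
  by rewrite (subset_trans JA sAS) !andbT.
rewrite -mulr_suml (eq_bigl (fun J : {set W} => (A \subset J) && (J \subset K))) => [|J].
  by rewrite sum_sign_interval // eq_sym (negPf KA) mul0r.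
case: (boolP (J \subset K)) => [JK|]; rewrite ?andbF //.
by rewrite (subset_trans JK KS) KS !andbT.
Qed.

Variables (R : realType) (W : finGroupType) (S : {set W}).
Hypothesis Scox : coxeter_system S.
Implicit Types (P : W -> R) (J : {set W}).

(** Both sides sum over words [u] the number of states fixed by [u], which is the sum of
    [multiplicity S J] over the [J] containing the letters of [u]. The weights are arbitrary so that
    [multiplicity_ge0] can pick some with distinct [lam P J]. *)
Lemma trace_walk P k : \tr (exchange_walk S P ^+ k) =
  \sum_(J : {set W} | J \subset S) (multiplicity S J)%:~R * lam P J ^+ k.
Proof.
transitivity (word_sum S P k
    (fun u => (#|redexps S (longest S (content u) * w0 S)%g|)%:R)).
  rewrite /mxtrace; under eq_bigr => i _ do rewrite walk_entry //.
  rewrite -word_sum_sum; apply: eq_word_sum => u Su _.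
  transitivity (\sum_(v in redexps S (w0 S))
      (greedy S 1%g (u ++ v) == v :> seq W)%:R : R); first by rewrite [RHS]big_enum_val.
  rewrite -card_fix // -sum1_card natr_sum [LHS]big_mkcond [RHS]big_mkcond /=.
  apply: eq_bigr => v _; rewrite [v \in [set _ in _ | _]]inE.
  by case: (v \in _); case: eqP.
under [RHS]eq_bigr => J JS do rewrite (lam_word_sum P k JS) -word_sumZ.
rewrite -word_sum_sum; apply: eq_word_sum => u Su _.
have sKS : content u \subset S by rewrite content_subset.
rewrite -[LHS]/(((#|redexps S (longest S (content u) * w0 S)%g|)%:Z)%:~R).
rewrite -sum_multiplicity // rmorph_sum /= big_mkcond [RHS]big_mkcond /=.
apply: eq_bigr => J _; rewrite content_subset.
by case: (J \subset S); case: (all _ u); rewrite ?mulr1 ?mulr0.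
Qed.

Lemma multiplicity_ge0 J : J \subset S -> 0 <= multiplicity S J.
Proof.
(* With P s = 2 ^ i for the i-th element s of S, the lam P J are distinct. *)
move=> sJS; pose P s : R := 2 ^+ index s (enum W).
have [/(_ (lam P J)) + _] := trace_powers_mult (trace_walk P).
rewrite (big_pred1 J) // => K; rewrite [RHS]/=.
apply/andP/eqP => [[sKS /eqP eqKJ]|->]; last by rewrite sJS.
suff lamE (A : {set W}) : lam P A = (\sum_(s in A) 2 ^ index s (enum W))%:R.
  move: eqKJ; rewrite !lamE => /eqP; rewrite eqr_nat => /eqP; exact: sum_pow2_inj.
by rewrite /lam natr_sum; apply: eq_bigr => s _; rewrite natrX.
Qed.

Lemma char_poly_walk P : char_poly (exchange_walk S P) =
  \prod_(J : {set W} | J \subset S) ('X - (lam P J)%:P) ^+ `|multiplicity S J|%N.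
Proof. exact: (trace_powers_mult (trace_walk P)).2 multiplicity_ge0. Qed.

Lemma eigenvalue_walk P a : eigenvalue (exchange_walk S P) a <->
  exists J, [/\ J \subset S, 0 < multiplicity S J & a = lam P J].
Proof.
rewrite eigenvalue_root_char char_poly_walk rootE horner_prod.
split=> [/prodf_eq0[J sJS]|[J [sJS mJ ->]]].
  rewrite horner_exp hornerXsubC expf_eq0 subr_eq0 absz_gt0 => /andP[mJ /eqP aJ].
  by exists J; rewrite lt_neqAle eq_sym mJ multiplicity_ge0.
apply/prodf_eq0; exists J => //.
by rewrite horner_exp hornerXsubC expf_eq0 subrr eqxx absz_gt0 gt_eqF.
Qed.

End Spectrum.

(** * Convergence *)

Section Convergence.
Variables (R : realType) (W : finGroupType) (S : {set W}).
Hypothesis Scox : coxeter_system S.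
Variable P : W -> R.
Hypothesis PS : prob_with_support S P.
Implicit Types (k : nat) (f g : seq W -> R) (s : W) (u v : seq W).

Local Notation wordS u := (all [in S] u).
Local Notation red u := (greedy S 1%g u).
Local Notation dem u := (dem_prod S 1%g u).
Local Notation len := (cox_len S).
Local Notation m := (cox_len S (w0 S)).
Local Notation p := (min_prob S P).
Local Notation T := (exchange_walk S P).
Local Notation lamD w := (lam P (right_descents S w)).

Lemma P_ge0 s : s \in S -> 0 <= P s.
Proof. by move=> /PS.1/ltW. Qed.

Lemma sum_P (c : R) : \sum_(s in S) P s * c = c.
Proof. by rewrite -mulr_suml PS.2 mul1r. Qed.

(** The denominators of [stat_weight] are thus the probabilities that the next letter lengthens the
    word. *)
Lemma escapeE w : 1 - lamD w = \sum_(s in S | (len w < len (w * s)%g)%N) P s.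
Proof.
rewrite -PS.2 (bigID (fun s => (len w < len (w * s)%g)%N)) /=.
rewrite /lam [X in _ - X](eq_bigl (fun s => (s \in S) && ~~ (len w < len (w * s)%g)%N)).
  by rewrite addrK.
by move=> s; rewrite right_descentsP.
Qed.

Lemma min_prob_gt0 : 0 < p.
Proof.
rewrite /min_prob; elim/big_ind: _ => // [x y x0 y0|s Ss]; last exact: PS.1.
by rewrite lt_min x0.
Qed.

Lemma min_prob_le s : s \in S -> p <= P s.
Proof. by move=> Ss; apply: bigmin_le_cond. Qed.

Lemma min_prob_le1 : p <= 1.
Proof. exact: bigmin_le_id. Qed.

Lemma ascent_exists w : w != w0 S -> exists2 s, s \in S & (len w < len (w * s)%g)%N.
Proof.
move=> ww0; have : ~~ (S \subset right_descents S w).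
  by apply: contra ww0 => /(w0_uniq Scox)->.
move=> /subsetPn[s Ss]; rewrite right_descentsP // Ss /= negbK.
by exists s.
Qed.

Lemma escape_ge w : w != w0 S -> p <= 1 - lamD w.
Proof.
move=> /ascent_exists[s Ss ws]; rewrite escapeE (bigD1 s) /= ?Ss //.
rewrite (le_trans (min_prob_le Ss)) // lerDl.
by apply: sumr_ge0 => t /andP[/andP[St _] _]; apply: P_ge0.
Qed.

Lemma escape_gt0 w : w != w0 S -> 0 < 1 - lamD w.
Proof. by move=> /escape_ge; apply: lt_le_trans min_prob_gt0. Qed.

Lemma escape_ge0 w : 0 <= 1 - lamD w.
Proof. by rewrite escapeE; apply: sumr_ge0 => s /andP[/P_ge0]. Qed.

(** The walk prepends letters, so letting [u] grow on the right extends the walk into the past, as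
    in coupling from the past. *)
Definition uncoalesced k : R := word_sum S P k (fun u => (dem u != w0 S)%:R).

Lemma uncoalescedS_le k : uncoalesced k.+1 <= uncoalesced k.
Proof.
rewrite /uncoalesced word_sum_rcons; apply: le_word_sum => // u Su.
rewrite -[leRHS]sum_P; apply: ler_sum => s Ss.
rewrite ler_wpM2l ?P_ge0 // ler_nat dem_prod_rcons.
case: (dem u =P w0 S) => [->|_]; last exact: leq_b1.
by rewrite dem_actE ?eqxx //; rewrite -leqNgt len_w0.
Qed.

Lemma dem_act_lengthening w : (len w)%:R + (w != w0 S)%:R * p <=
  \sum_(s in S) P s * (len (dem_act S w s))%:R :> R.
Proof.
have -> : \sum_(s in S) P s * (len (dem_act S w s))%:R =
    (len w)%:R + (1 - lamD w) :> R.
  rewrite escapeE -[X in X + _]sum_P [X in _ + X]big_mkcondr /=.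
  rewrite -big_split /=; apply: eq_bigr => s Ss; rewrite /dem_act.
  case: ifP => ws; last by rewrite addr0.
  have /orP[/eqP->|/eqP ws'] := len_genr Scox w Ss.
    by rewrite -natr1 mulrDr mulr1.
  by move: ws; rewrite -ws' ltnNge leqnSn.
rewrite lerD2l; case: eqP => /= [_|/eqP /escape_ge]; last by rewrite mul1r.
by rewrite mul0r escape_ge0.
Qed.

(* The expected length of the Demazure product of k letters grows by at least
   p * uncoalesced k at each step, and it is bounded by m. *)
Lemma uncoalesced_bound k : k%:R * p * uncoalesced k <= m%:R.
Proof.
suff lenk : k%:R * p * uncoalesced k <= word_sum S P k (fun u => (len (dem u))%:R).
  apply: le_trans lenk _; rewrite -(word_sum_const PS k m%:R).
  by apply: le_word_sum => // u Su; rewrite ler_nat len_w0.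
elim: k => [|k IHk]; first by rewrite !mul0r.
rewrite word_sum_rcons; apply: (@le_trans _ _ (word_sum S P k
    (fun u => (len (dem u))%:R + p * (dem u != w0 S)%:R))); last first.
  apply: le_word_sum => // u Su; rewrite mulrC.
  by under [leRHS]eq_bigr do rewrite dem_prod_rcons; exact: dem_act_lengthening.
rewrite word_sumD word_sumZ -natr1 !mulrDl mul1r lerD //.
  apply: le_trans IHk; rewrite ler_wpM2l ?uncoalescedS_le //.
  by rewrite mulr_ge0 ?ler0n ?(ltW min_prob_gt0).
by rewrite ler_wpM2l ?uncoalescedS_le ?(ltW min_prob_gt0).
Qed.

Definition coalesced k v : R := word_sum S P k (fun u => (red u == v)%:R).

Lemma coalesced_ge0 k v : 0 <= coalesced k v.
Proof.
by rewrite -(word_sum_const PS k 0); apply: le_word_sum.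
Qed.

(* Once the letters used so far have Demazure product w_0, the current state no
   longer depends on the initial one. *)
Lemma coalesced_le_walk k (i j : 'I_(num_states S)) :
  coalesced k (state i) <= (T ^+ k) i j.
Proof.
rewrite walk_entry //; apply: le_word_sum => // u Su; rewrite ler_nat.
case: eqP => //= ui; have := state_reduced i; rewrite -ui greedy_reduced // => /eqP uw0.
by rewrite greedy_cat uw0 greedy_w0 ?state_word // cats0 eqxx.
Qed.

Lemma sum_coalesced k : \sum_(i < num_states S) coalesced k (state i) = 1 - uncoalesced k.
Proof.
rewrite -word_sum_sum -[X in X - _](word_sum_const PS k) -mulN1r -word_sumZ -word_sumD.
apply: eq_word_sum => u Su _.
have := @sum_state R _ _ (red u) (fun=> 1) (all_greedy _ _ Su).
under eq_bigr do rewrite mulr1; move=> ->; rewrite greedy_reduced // mulr1.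
by case: eqP; rewrite /= ?mulr0 ?mulr1 ?addr0 ?subrr.
Qed.

Lemma walk_ge0 k (i j : 'I_(num_states S)) : 0 <= (T ^+ k) i j.
Proof. exact: le_trans (coalesced_ge0 _ _) (coalesced_le_walk _ _ _). Qed.

Lemma sum_walk k (j : 'I_(num_states S)) : \sum_i (T ^+ k) i j = 1.
Proof.
under eq_bigr => i _ do rewrite walk_entry //.
rewrite -word_sum_sum -[RHS](word_sum_const PS k); apply: eq_word_sum => u Su _.
have Suj : wordS (u ++ state j) by rewrite all_cat Su state_word.
have := @sum_state R _ _ (red (u ++ state j)) (fun=> 1) (all_greedy _ _ Suj).
under eq_bigr do rewrite mulr1; move=> ->.
by rewrite greedy_cat_reduced ?state_reduced // mulr1.
Qed.

(** * Stationary weights *)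

Lemma stat_weight_nil : stat_weight S P [::] = 1.
Proof. by rewrite /stat_weight big_ord0. Qed.

Lemma stat_weight_rcons v s : stat_weight S P (rcons v s) =
  stat_weight S P v * (P s / (1 - lamD (word_val v))).
Proof.
rewrite /stat_weight.
pose F w i := P (nth 1%g w i) / (1 - lamD (word_val (take i w))).
rewrite -(big_mkord xpredT (F (rcons v s))) -(big_mkord xpredT (F v)).
rewrite size_rcons big_nat_recr //= /F nth_rcons ltnn eqxx.
have -> : take (size v) (rcons v s) = v by rewrite -cats1 take_size_cat.
congr (_ * _).
apply: eq_big_nat => i /andP[_ iv]; rewrite nth_rcons iv -cats1 takel_cat //.
exact: ltnW.
Qed.

Lemma geodesic_rcons v s : geodesic S (rcons v s) ->
  [/\ geodesic S v, s \in S & (len (word_val v) < len (word_val v * s)%g)%N].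
Proof.
move=> /geodesicP[]; rewrite all_rcons size_rcons word_val_rcons => /andP[Ss Sv] vs.
have lev := len_le Scox Sv.
split=> //; last by rewrite -vs ltnS.
apply/geodesicP; split=> //; apply/eqP; rewrite eqn_leq lev andbT -ltnS vs.
by have /orP[/eqP->|/eqP <-] := len_genr Scox (word_val v) Ss; rewrite ?ltnS // -ltnS leqW.
Qed.

Lemma geodesic_rconsE v s : geodesic S v -> s \in S ->
  geodesic S (rcons v s) = (len (word_val v) < len (word_val v * s)%g)%N.
Proof.
move=> gv Ss; apply/idP/idP => [/geodesic_rcons[]//|vs].
have /geodesicP[Sv sv] := gv; apply/geodesicP.
rewrite all_rcons Ss Sv size_rcons word_val_rcons sv; split=> //.
by move: vs; case/orP: (len_genr Scox (word_val v) Ss) => /eqP <- //; rewrite ltnNge leqnSn.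
Qed.

Lemma ascent_neq_w0 w s : (len w < len (w * s)%g)%N -> w != w0 S.
Proof. by apply: contraTneq => ->; rewrite -leqNgt len_w0. Qed.

Lemma stat_weight_gt0 v : geodesic S v -> 0 < stat_weight S P v.
Proof.
elim/last_ind: v => [_|v s IHv /geodesic_rcons[gv Ss vs]].
  by rewrite stat_weight_nil ltr01.
rewrite stat_weight_rcons mulr_gt0 ?IHv // divr_gt0 ?PS.1 //.
by rewrite escape_gt0 // (ascent_neq_w0 vs).
Qed.

(** The reduction is [v] after [k.+1] letters either because it was [v] already and the last letter
    was a descent, or because the last letter was kept. *)
Lemma coalescedS_le k v : coalesced k.+1 v <=
  lamD (word_val v) * coalesced k v +
  word_sum S P k (fun u => \sum_(s in S) P s * (rcons (red u) s == v)%:R).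
Proof.
rewrite /coalesced word_sum_rcons -word_sumZ -word_sumD.
apply: le_word_sum => // u Su.
have -> : lamD (word_val v) =
    \sum_(s in S) P s * (s \in right_descents S (word_val v))%:R.
  rewrite /lam big_mkcond [RHS]big_mkcond /=; apply: eq_bigr => s _.
  by rewrite right_descentsP //; case: (s \in S) => //=; case: (~~ _); rewrite ?mulr1 ?mulr0.
rewrite mulr_suml -big_split /=; apply: ler_sum => s Ss.
rewrite -mulrA -mulrDr ler_wpM2l ?P_ge0 // greedy_rcons.
case: ifP => us; first by rewrite lerDr mulr_ge0 ?ler0n.
case: (red u =P v) => [uv|_]; last by rewrite addr_ge0 ?mulr_ge0 ?ler0n.
by rewrite -uv word_val_greedy1 right_descentsP // Ss us mulr1 lerDl ler0n.
Qed.

Lemma coalesced_rcons_le k v s : s \in S -> coalesced k.+1 (rcons v s) <=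
  lamD (word_val (rcons v s)) * coalesced k (rcons v s) + P s * coalesced k v.
Proof.
move=> Ss; apply: (le_trans (coalescedS_le _ _)); rewrite lerD2l -word_sumZ.
rewrite le_eqVlt; apply/orP; left; apply/eqP; apply: eq_word_sum => u _ _.
rewrite (bigD1 s) //= big1 ?addr0 => [|t /andP[_ ts]].
  by rewrite eqseq_rcons eqxx andbT.
by rewrite eqseq_rcons (negPf ts) andbF mulr0.
Qed.

Lemma coalesced_nil_le k : coalesced k.+1 [::] <= lamD 1%g * coalesced k [::].
Proof.
apply: (le_trans (coalescedS_le _ _)); rewrite word_val_nil gerDl.
rewrite le_eqVlt; apply/orP; left; apply/eqP.
rewrite -[RHS](word_sum0 S P k); apply: eq_word_sum => u _ _.
by rewrite big1 // => s _; rewrite -cats1 -size_eq0 size_cat addn1 mulr0.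
Qed.

(* The sum is the expected number of steps, among the first k, that the growing
   greedy reduction spends at v; each of them is the last one with probability
   1 - lambda_{D_R(v)}. *)
Lemma green_bound k v : geodesic S v ->
  coalesced k v + (1 - lamD (word_val v)) * \sum_(j < k) coalesced j v
  <= stat_weight S P v.
Proof.
elim/last_ind: v k => [|v s IHv] k gv.
  rewrite stat_weight_nil word_val_nil; elim: k => [|k IHk].
    by rewrite big_ord0 mulr0 addr0 /coalesced /= lexx.
  apply: le_trans IHk; rewrite big_ord_recr /=; have := coalesced_nil_le k; lra.
have [gv' Ss vs] := geodesic_rcons gv.
have esc0 := escape_gt0 (ascent_neq_w0 vs).
(* A stay at [rcons v s] starts by reading [s] while at [v], so it is charged to the time spent at
   [v]. *)
apply: (@le_trans _ _ (P s * \sum_(j < k) coalesced j v)).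
  elim: k => [|k IHk].
    rewrite !big_ord0 !mulr0 addr0 /coalesced.
    by case: (v) => [|t v'] /=; rewrite lexx.
  rewrite !big_ord_recr /=; have := coalesced_rcons_le k v Ss; lra.
rewrite stat_weight_rcons mulrCA ler_wpM2l ?P_ge0 // ler_pdivlMr // mulrC.
by apply: le_trans (IHv k gv'); rewrite lerDr coalesced_ge0.
Qed.

Lemma coalesced_le_stat k (i : 'I_(num_states S)) :
  coalesced k (state i) <= stat_weight S P (state i).
Proof.
have := state_reduced i; rewrite reduced_wordE => /andP[gi _].
apply: le_trans (green_bound k gi); rewrite lerDl mulr_ge0 ?escape_ge0 //.
by apply: sumr_ge0 => j _; apply: coalesced_ge0.
Qed.

Lemma geodesic_size_w0 v : geodesic S v -> size v = m ->
  reduced_word S (w0 S) v.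
Proof.
move=> gv vm; rewrite reduced_wordE gv; apply/eqP/w0_uniq => //.
apply/subsetP => s Ss; rewrite right_descentsP // Ss -leqNgt.
by have /geodesicP[_ <-] := gv; rewrite vm len_w0.
Qed.

(** Below [w0 S], the probabilities of the next letter conditioned on lengthening sum to 1, so no
    mass is lost. Letters have weight 1 in [word_sum] since [stat_weight] already contains [P]. *)
Lemma sum_stat_geodesics k : (k <= m)%N ->
  word_sum S (fun=> 1) k (fun u => (geodesic S u)%:R * stat_weight S P u) = 1.
Proof.
elim: k => [|k IHk] km.
  rewrite /= stat_weight_nil mulr1; suff -> : geodesic S [::] by [].
  by apply/geodesicP; rewrite word_val_nil len1.
rewrite word_sum_rcons -[RHS](IHk (ltnW km)); apply: eq_word_sum => u Su uk.
case: (boolP (geodesic S u)) => [gu|ngu]; last first.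
  rewrite mul0r big1 // => s Ss; case: (boolP (geodesic _ _)) => [|_]; last by rewrite mul0r mulr0.
  by move/geodesic_rcons=> [gu]; rewrite gu in ngu.
have uw0 : word_val u != w0 S.
  have /geodesicP[_ us] := gu; apply: contraTneq km => uw0.
  by rewrite -uw0 -us uk ltnn.
transitivity (stat_weight S P u *
    ((\sum_(s in S | (len (word_val u) < len (word_val u * s)%g)%N) P s) /
     (1 - lamD (word_val u)))); last first.
  by rewrite -escapeE divff ?mulr1 ?mul1r // gt_eqF ?escape_gt0.
rewrite big_distrl mulr_sumr [RHS]big_mkcondr /=.
apply: eq_bigr => s Ss; rewrite geodesic_rconsE // stat_weight_rcons mul1r.
by case: ifP; rewrite ?mul1r ?mul0r.
Qed.

Lemma sum_stat : \sum_(i < num_states S) stat_weight S P (state i) = 1.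
Proof.
rewrite -(sum_stat_geodesics (leqnn m)).
transitivity (word_sum S (fun=> 1 : R) m (fun u =>
    \sum_(i < num_states S) (u == state i)%:R * stat_weight S P (state i))).
  rewrite word_sum_sum; apply: eq_bigr => i _.
  under eq_word_sum => u _ _ do rewrite mulrC.
  rewrite word_sumZ word_sum_indic ?state_word ?big1 ?mulr1 //.
  by case/and3P: (state_reduced i) => _ _ /eqP.
apply: eq_word_sum => u Su um; rewrite (sum_state (stat_weight S P)) //.
congr (_%:R * _); congr nat_of_bool; apply/idP/idP => [|gu].
  by rewrite reduced_wordE => /andP[].
exact: geodesic_size_w0.
Qed.

Lemma stat_distribution : distribution (stat_distr S P).
Proof.
split=> [i|]; last by under eq_bigr do rewrite mxE; apply: sum_stat.
have := state_reduced i; rewrite mxE reduced_wordE => /andP[gi _].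
exact/ltW/stat_weight_gt0.
Qed.

(** * Total variation bounds *)

Lemma walk_distribution k (nu : 'cV[R]_(num_states S)) :
  distribution nu -> distribution (T ^+ k *m nu).
Proof.
move=> [nu0 nu1]; split=> [i|].
  by rewrite mxE; apply: sumr_ge0 => j _; rewrite mulr_ge0 ?walk_ge0.
under eq_bigr do rewrite mxE; rewrite exchange_big /= -nu1.
by apply: eq_bigr => j _; rewrite -mulr_suml sum_walk mul1r.
Qed.

Lemma coalesced_le_law k (nu : 'cV[R]_(num_states S)) i :
  distribution nu -> coalesced k (state i) <= (T ^+ k *m nu) i 0.
Proof.
move=> [nu0 nu1]; rewrite mxE -[leLHS]mulr1 -nu1 mulr_sumr.
by apply: ler_sum => j _; rewrite ler_wpM2r ?coalesced_le_walk.
Qed.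

(** Both laws dominate a common part [q] of mass [1 - d], so on any event each exceeds it by an
    amount between 0 and [d]. *)
Lemma tv_dist_le n (mu nu : 'cV[R]_n) (q : 'I_n -> R) (d : R) :
  distribution mu -> distribution nu ->
  (forall i, q i <= mu i 0) -> (forall i, q i <= nu i 0) ->
  \sum_i q i = 1 - d -> tv_dist mu nu <= d.
Proof.
move=> [_ mu1] [_ nu1] qmu qnu qd.
have bound (x : 'cV[R]_n) (A : {set 'I_n}) :
    (forall i, q i <= x i 0) -> \sum_i x i 0 = 1 ->
    0 <= \sum_(i in A) x i 0 - \sum_(i in A) q i <= d.
  move=> qx x1; rewrite -sumrB; apply/andP; split.
    by apply: sumr_ge0 => i _; rewrite subr_ge0.
  have -> : d = \sum_i (x i 0 - q i) by rewrite sumrB x1 qd; lra.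
  rewrite [leRHS](bigID (mem A)) /= lerDl.
  by apply: sumr_ge0 => i _; rewrite subr_ge0.
apply: bigmax_le => [|A _].
  by have := bound mu set0 qmu mu1; lra.
have := bound mu A qmu mu1; have := bound nu A qnu nu1.
by rewrite ler_norml; lra.
Qed.

Lemma tv_walk_le k (nu : 'cV[R]_(num_states S)) :
  distribution nu -> tv_dist (T ^+ k *m nu) (stat_distr S P) <= uncoalesced k.
Proof.
move=> dnu; apply: (tv_dist_le (q := fun i => coalesced k (state i))).
- exact: walk_distribution.
- exact: stat_distribution.
- by move=> i; apply: coalesced_le_law.
- by move=> i; rewrite mxE coalesced_le_stat.
- exact: sum_coalesced.
Qed.

(** * Ergodicity, stationarity and mixing time *)

Lemma len_w0_gt0 : (0 < m)%N.
Proof.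
have [s Ss] : exists s, s \in S.
  apply/set0Pn; apply/eqP => S0; have := PS.2; rewrite S0 big_set0.
  by move/eqP; rewrite eq_sym oner_eq0.
by rewrite -(len_gen Scox Ss) len_w0.
Qed.

Lemma uncoalesced_le (e : R) k : 0 < e -> m%:R / (p * e) <= k%:R -> uncoalesced k <= e.
Proof.
move=> e0 mk; have p0 := min_prob_gt0; have m0 : 0 < m%:R :> R by rewrite ltr0n len_w0_gt0.
have k0 : 0 < k%:R :> R by apply: lt_le_trans mk; rewrite divr_gt0 ?mulr_gt0.
rewrite -(ler_pM2l (mulr_gt0 k0 p0)); apply: le_trans (uncoalesced_bound k) _.
by move: mk; rewrite ler_pdivrMr ?mulr_gt0 // mulrA.
Qed.

Lemma uncoalesced_small (e : R) : 0 < e -> exists K, forall k, (K <= k)%N -> uncoalesced k <= e.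
Proof.
move=> e0; exists (Num.truncn (m%:R / (p * e))).+1 => k Kk.
apply: uncoalesced_le => //; apply: le_trans (ltW (truncnS_gt _)) _.
by rewrite ler_nat.
Qed.

(** The deficits of [coalesced k] below [stat_weight] are nonnegative with sum [uncoalesced k], so
    none exceeds it. *)
Lemma stat_sub_uncoalesced_le k (i : 'I_(num_states S)) :
  stat_weight S P (state i) - uncoalesced k <= coalesced k (state i).
Proof.
have : \sum_(j < num_states S)
    (stat_weight S P (state j) - coalesced k (state j)) = uncoalesced k.
  by rewrite sumrB sum_stat sum_coalesced; lra.
rewrite (bigD1 i) //=; set rest := (X in _ + X) => eq_miss.
suff : 0 <= rest by lra.
by apply: sumr_ge0 => j _; rewrite subr_ge0 coalesced_le_stat.
Qed.

Lemma walk_eventually_gt0 (i : 'I_(num_states S)) :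
  exists K, forall k j, (K <= k)%N -> 0 < (T ^+ k) i j.
Proof.
have := state_reduced i; rewrite reduced_wordE => /andP[/stat_weight_gt0 pi0 _].
(* With this error, at least half the weight of state [i] bounds every entry of row [i] from
   below. *)
have [|K HK] := @uncoalesced_small (stat_weight S P (state i) / 2); first lra.
exists K => k j /HK; have := stat_sub_uncoalesced_le k i; have := coalesced_le_walk k i j.
lra.
Qed.

Lemma ergodic_walk : ergodic T.
Proof.
split=> [i j|i d div_d].
  by have [K HK] := walk_eventually_gt0 i; exists K; apply: HK.
have [K HK] := walk_eventually_gt0 i.
(* Possible returns at two consecutive times force [d] to divide 1. *)
have d1 := div_d K.+1 (ltn0Sn _) (HK _ i (leqnSn K)).
have d2 := div_d K.+2 (ltn0Sn _) (HK _ i (leqW (leqnSn K))).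
apply/eqP; rewrite -dvdn1 -(subSnn K.+1).
exact: dvdn_sub.
Qed.

Lemma tv_dist_ge n (mu nu : 'cV[R]_n) i : `|mu i 0 - nu i 0| <= tv_dist mu nu.
Proof.
have := le_bigmax (0 : R) (fun A : {set 'I_n} =>
  `|\sum_(i in A) mu i 0 - \sum_(i in A) nu i 0|) [set i].
by rewrite !big_set1.
Qed.

Lemma eq_of_dist (x y : R) : (forall e, 0 < e -> `|x - y| <= e) -> x = y.
Proof.
move=> xy; apply/eqP; rewrite -subr_eq0 -normr_eq0; apply/negP => /negP.
rewrite -normr_gt0 normr_id => d0.
by have := xy (`|x - y| / 2); lra.
Qed.

Lemma walk_law_close k (nu : 'cV[R]_(num_states S)) i : distribution nu ->
  `|(T ^+ k *m nu) i 0 - stat_distr S P i 0| <= uncoalesced k.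
Proof. by move=> dnu; apply: le_trans (tv_dist_ge _ _ i) (tv_walk_le k dnu). Qed.

Lemma stat_distr_fixed : T *m stat_distr S P = stat_distr S P.
Proof.
set pi := stat_distr S P; apply/colP => i; apply: eq_of_dist => e e0.
pose n : R := (num_states S)%:R; have n0 : 0 <= n by rewrite ler0n.
(* The [n + 1] counts one error per state, from applying [T] to [pi - T ^+ K *m pi], and one for
   replacing [T ^+ K.+1 *m pi] by [pi]. *)
have [|K HK] := @uncoalesced_small (e / (n + 1)); first by rewrite divr_gt0 //; lra.
have uncoalescedK : uncoalesced K * (n + 1) <= e by rewrite -ler_pdivlMr ?HK //; lra.
have dpi := stat_distribution.
have step : `|(T *m pi) i 0 - (T ^+ K.+1 *m pi) i 0| <= uncoalesced K * n.
  rewrite exprS -[_ * _]/(_ *m _) -mulmxA !mxE -sumrB.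
  apply: le_trans (ler_norm_sum _ _ _) _.
  apply: (@le_trans _ _ (\sum_(j < num_states S) uncoalesced K)); last first.
    by rewrite sumr_const card_ord mulr_natr.
  apply: ler_sum => j _; rewrite -mulrBr normrM -[leRHS]mul1r distrC.
  have T0 := walk_ge0 1 i j; rewrite expr1 in T0.
  rewrite ler_pM ?normr_ge0 ?walk_law_close // ger0_norm //.
  rewrite -(sum_walk 1 j) expr1 (bigD1 i) //= lerDl.
  by apply: sumr_ge0 => l _; have := walk_ge0 1 l j; rewrite expr1.
have := walk_law_close K.+1 i dpi; have := uncoalescedS_le K.
move: step; rewrite -/pi !ler_norml; lra.
Qed.

Lemma stationaryP (nu : 'cV[R]_(num_states S)) :
  stationary T nu <-> nu = stat_distr S P.
Proof.
split=> [[dnu Tnu]|->]; last by split; [exact: stat_distribution | exact: stat_distr_fixed].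
have Tk k : T ^+ k *m nu = nu.
  elim: k => [|k IHk]; first by rewrite expr0 mul1mx.
  by rewrite exprS -[_ * _]/(_ *m _) -mulmxA IHk.
apply/colP => i; apply: eq_of_dist => e /uncoalesced_small[K /(_ K (leqnn K))].
by apply: le_trans; rewrite -{1}(Tk K) walk_law_close.
Qed.

Lemma max_dist_le k : max_dist T (stat_distr S P) k <= uncoalesced k.
Proof.
apply: ge_sup.
  by exists (tv_dist (T ^+ k *m stat_distr S P) (stat_distr S P)), (stat_distr S P);
     first exact: stat_distribution.
by move=> _ [nu dnu <-]; apply: tv_walk_le.
Qed.

Lemma mixing_time_le (e : R) : 0 < e ->
  exists2 t : nat, is_mixing_time T (stat_distr S P) e t &
    t%:R <= (e^-1 + 1) * (m%:R / p).
Proof.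
(* By [uncoalesced_le], any number of steps at least [x] suffices; rounding costs at most one
   more. *)
move=> e0; set x := m%:R / (p * e); pose k0 := (Num.truncn x).+1.
have k0P : max_dist T (stat_distr S P) k0 <= e.
  apply: le_trans (max_dist_le _) (uncoalesced_le e0 _).
  exact/ltW/truncnS_gt.
have exk : exists k, max_dist T (stat_distr S P) k <= e by exists k0.
case: (ex_minnP exk) => t te tmin; exists t => //.
apply: (@le_trans _ _ k0%:R); first by rewrite ler_nat tmin.
have p0 := min_prob_gt0.
have x0 : 0 <= x by rewrite divr_ge0 ?ler0n // mulr_ge0 // ltW.
(* This absorbs the rounding step into the summand 1 of [e^-1 + 1]. *)
have mp1 : 1 <= m%:R / p.
  by rewrite ler_pdivlMr // mul1r (le_trans min_prob_le1) // ler1n len_w0_gt0.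
rewrite -natr1 mulrDl mul1r lerD //.
have -> : e^-1 * (m%:R / p) = x by rewrite /x invfM mulrC mulrA.
by rewrite truncn_le.
Qed.

Lemma uniform_mixing_bound : {in S, forall s, P s = #|S|%:R^-1} ->
  m%:R / p <= (m * #|S|)%:R.
Proof.
move=> Pu; have S0 : 0 < #|S|%:R :> R.
  rewrite ltr0n lt0n cards_eq0; apply: contraTneq len_w0_gt0 => S0.
  by have := PS.2; rewrite S0 big_set0 => /esym/eqP; rewrite oner_eq0.
rewrite natrM ler_wpM2l ?ler0n // -[leRHS]invrK lef_pV2 ?posrE ?invr_gt0 //.
  apply: le_bigmin => [|s Ss]; last by rewrite Pu.
  (* The default value 1 of the minimum must also be at least the inverse of [#|S|]. *)
  by rewrite invf_le1 // ler1n -(ltr0n R).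
exact: min_prob_gt0.
Qed.

End Convergence.

Theorem theorem8p1 (R : realType) :
  (forall (W : finGroupType) (S : {set W}) (P : W -> R),
     coxeter_system S -> prob_with_support S P ->
     let T := exchange_walk S P in
     [/\ ergodic T,
         forall a : R, eigenvalue T a <->
           exists J : {set W},
             [/\ J \subset S, 0 < multiplicity S J & a = lam P J],
         (forall J : {set W}, J \subset S -> 0 <= multiplicity S J) /\
         char_poly T =
           \prod_(J : {set W} | J \subset S)
             ('X - (lam P J)%:P) ^+ `|multiplicity S J|%N &
         forall nu : 'cV[R]_(num_states S),
           stationary T nu <-> nu = stat_distr S P]) /\
  (forall eps : R, 0 < eps ->
     exists2 C : R, 0 < C &
       forall (W : finGroupType) (S : {set W}) (P : W -> R),
         coxeter_system S -> prob_with_support S P ->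
         exists2 t : nat,
           is_mixing_time (exchange_walk S P) (stat_distr S P) eps t &
           t%:R <= C * ((cox_len S (w0 S))%:R / min_prob S P)) /\
  (forall eps : R, 0 < eps ->
     exists2 C : R, 0 < C &
       forall (W : finGroupType) (S : {set W}) (P : W -> R),
         coxeter_system S -> prob_with_support S P ->
         {in S, forall s, P s = #|S|%:R^-1} ->
         exists2 t : nat,
           is_mixing_time (exchange_walk S P) (stat_distr S P) eps t &
           t%:R <= C * (cox_len S (w0 S) * #|S|)%:R).
Proof.
split; last split.
- move=> W S P Scox PS T; split.
  + exact: ergodic_walk.
  + exact: eigenvalue_walk.
  + split; [exact: (multiplicity_ge0 R Scox) | exact: char_poly_walk].
  + exact: stationaryP.
- move=> eps eps0; exists (eps^-1 + 1); first by rewrite addr_gt0 ?invr_gt0.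
  by move=> W S P Scox PS; apply: mixing_time_le.
- move=> eps eps0; have C0 : 0 < eps^-1 + 1 by rewrite addr_gt0 ?invr_gt0.
  exists (eps^-1 + 1) => // W S P Scox PS Pu.
  have [t tmix tle] := mixing_time_le Scox PS eps0; exists t => //.
  by apply: le_trans tle _; rewrite ler_pM2l // uniform_mixing_bound.
Qed.
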